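(* Let $\mathbb{H}$ be an infinite-dimensional separable real Hilbert space (of functions), let $x_1,\dots,x_n\in\mathbb{R}^p$ be vectors of scalar covariates such that the $n\times p$ matrix $X$ with rows $x_i^T$ has $X^TX$ invertible, and let $y_1,\dots,y_n\in\mathbb{H}$ be $n$ independent realizations of the function-on-scalar regression model $$Y_i=x_i^T\beta+\varepsilon_i,\qquad i=1,\dots,n,$$ where $\beta=(\beta_1,\dots,\beta_p)\in\mathbb{H}^p$ is the vector of functional parameters, $x_i^T\beta=\sum_{k=1}^p x_{ik}\beta_k$, and the $\varepsilon_i$ are independent copies of an $\mathbb{H}$-valued Gaussian random element with mean zero and covariance operator $C$. Then the maximum kernel mean (MKM) estimate of the functional regression parameter $\beta$ coincides with the ordinary least squares estimate $(X^TX)^{-1}X^TY$, where $Y=(y_1,\dots,y_n)^T$.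
   Context: An $\mathbb{H}$-valued random element $Z$ is Gaussian with mean $\mu$ and covariance operator $C$, written $Z\sim\mathcal{N}(\mu,C)$, if $\langle a,Z\rangle\sim N(\langle a,\mu\rangle,\langle Ca,a\rangle)$ for all $a\in\mathbb{H}$; $C$ is then self-adjoint, nonnegative and trace class. Fix $\sigma>0$. The MKM estimate of $\beta$ is the maximizer over $\beta\in\mathbb{H}^p$ (with $C$ and $\sigma$ fixed) of the kernel mean function for the Gaussian product-kernel on $\mathbb{H}^n$, evaluated at the data, $$m_\beta(y_1,\dots,y_n)=\int_{\mathbb{H}^n}e^{-\sigma\sum_{i=1}^n\|y_i-z_i\|_{\mathbb{H}}^2}\ \bigotimes_{i=1}^n\mathcal{N}(x_i^T\beta,C)(dz_i),$$ or equivalently of $\log m_\beta(y_1,\dots,y_n)$. The product $(X^TX)^{-1}X^TY\in\mathbb{H}^p$ is formed by the usual matrix rule, with real scalars acting on elements of $\mathbb{H}$. *)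

(* Defs.v *)
From HB Require Import structures.
From mathcomp Require Import all_boot all_order all_algebra sesquilinear.
From mathcomp Require Import all_classical all_reals all_analysis.

Set Implicit Arguments.
Unset Strict Implicit.
Unset Printing Implicit Defensive.

Import Order.TTheory GRing.Theory Num.Theory.
Import numFieldNormedType.Exports.

Local Open Scope classical_set_scope.
Local Open Scope ring_scope.

HB.mixin Record CompleteNormedModule_isHilbert (R : realType) H
    of CompleteNormedModule R H := {
  inner : {dot H for @idfun R} ;
  inner_norm : forall x : H, inner x x = `|x| ^+ 2 }.

#[short(type="hilbertType")]
HB.structure Definition Hilbert (R : realType) :=
  {H of CompleteNormedModule R H & CompleteNormedModule_isHilbert R H}.

Definition separable (T : topologicalType) : Prop :=
  exists2 D : set T, countable D & dense D.

Definition infinite_dimensional (R : realType) (V : lmodType R) : Prop :=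
  forall (m : nat) (v : 'I_m -> V),
    exists h : V, forall c : 'I_m -> R, h <> \sum_(i < m) c i *: v i.

Definition orthonormal_basis (R : realType) (H : hilbertType R)
    (e : nat -> H) : Prop :=
  (forall i j, inner (e i) (e j) = (i == j)%:R) /\
  (forall x : H, (forall i, inner x (e i) = 0) -> x = 0).

(* For a nonnegative operator, summability of the diagonal in one orthonormal
   basis is equivalent to summability in all of them, and is the definition of
   being trace class.  Bases are indexed by nat, so this is only meant for
   separable infinite-dimensional spaces. *)
Definition covariance_operator (R : realType) (H : hilbertType R)
    (C : {linear H -> H}) : Prop :=
  [/\ continuous (C : H -> H),
      (forall a b, inner (C a) b = inner a (C b)),
      (forall a, 0 <= inner (C a) a) &
      exists2 e : nat -> H, orthonormal_basis e &
        cvgn (series (fun k => inner (C (e k)) (e k)))].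

Definition borel (T : ptopologicalType) := g_sigma_algebraType (@open T).

(* The normal law with mean m and variance v >= 0.  The case v = 0 is the point
   mass at m, whereas normal_prob m 0 is the uniform law on `[0, 1]. *)
Definition normal_law (R : realType) (m v : R) : set R -> \bar R :=
  if v == 0 then dirac m else normal_prob m (Num.sqrt v).

Definition is_gaussian (R : realType) (H : hilbertType R)
    (Q : probability (borel H) R) (mu : H) (C : H -> H) : Prop :=
  forall (a : H) (B : set R), measurable B ->
    pushforward Q (fun z : borel H => inner a (z : H)) B =
    normal_law (inner a mu) (inner (C a) a) B.

(* The measure N(mu, C).  When H is separable and C is a covariance operator,
   there is exactly one such measure; the point mass is an unused default. *)
Definition gaussian (R : realType) (H : hilbertType R) (mu : H) (C : H -> H) :
    probability (borel H) R :=
  xget (dirac (0 : borel H) : pprobability (borel H) R)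
    [set Q : pprobability (borel H) R | is_gaussian Q mu C].

Section product_probability.
Context d (T : measurableType d) (R : realType).

Definition cons_pair n (x : T * n.-tuple T) : n.+1.-tuple T :=
  [tuple of x.1 :: x.2].

Lemma measurable_cons_pair n : measurable_fun [set: T * n.-tuple T] (@cons_pair n).
Proof. exact: measurable_cons. Qed.

HB.instance Definition _ n :=
  isMeasurableFun.Build _ _ _ _ (@cons_pair n) (@measurable_cons_pair n).

Fixpoint product_prob n : ('I_n -> probability T R) -> probability (n.-tuple T) R :=
  match n with
  | 0 => fun _ => dirac [tuple]
  | n'.+1 => fun Q =>
      distribution (Q ord0 \x product_prob (fun i => Q (lift ord0 i)))%E (@cons_pair n')
  end.

Lemma product_probE n (Q : 'I_n -> probability T R) (A : 'I_n -> set T) :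
  (forall i, measurable (A i)) ->
  product_prob Q [set z | forall i, A i (tnth z i)] = (\prod_(i < n) Q i (A i))%E.
Proof.
elim: n Q A => [|n IH] Q A mA /=.
  rewrite big_ord0 diracE mem_set//=; by case.
have mC : measurable [set z : n.-tuple T | forall i, A (lift ord0 i) (tnth z i)].
  rewrite [X in measurable X](_ : _ = \bigcap_i ((@tnth _ T)^~ i @^-1` A (lift ord0 i))).
    apply: fin_bigcap_measurable => // i _; rewrite -[X in measurable X]setTI.
    exact: measurable_tnth.
  by apply/seteqP; split => z h i //=; exact: h.
rewrite /distribution /pushforward big_ord_recl -IH // -product_measure1E //.
congr (_ _); apply/seteqP; split => -[x z] /=.
  move=> h; split; first by have := h ord0.
  by move=> i; have := h (lift ord0 i); rewrite /cons_pair tnthS.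
by move=> [h0 h] i; case: (unliftP ord0 i) => [j|] -> ; rewrite /cons_pair ?tnthS //; apply: h.
Qed.

End product_probability.

(* For finitely many random elements, the product rule over all indices implies
   the one over every subfamily: take A i = setT for the other indices. *)
Definition mutually_independent d d' (T : measurableType d)
    (T' : measurableType d') (R : realType) (P : probability T R) n
    (Z : 'I_n -> {RV P >-> T'}) : Prop :=
  forall A : 'I_n -> set T', (forall i, measurable (A i)) ->
    P (\bigcap_i (Z i @^-1` A i)) = (\prod_(i < n) P (Z i @^-1` A i))%E.

Definition mulmxH (R : realType) (V : lmodType R) m n (A : 'M[R]_(m, n))
    (v : 'I_n -> V) : 'I_m -> V :=
  fun i => \sum_(j < n) A i j *: v j.

Definition ols (R : realType) (V : lmodType R) n p (X : 'M[R]_(n, p))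
    (y : 'I_n -> V) : 'I_p -> V :=
  mulmxH (invmx (X^T *m X) *m X^T) y.

Definition kernel_mean (R : realType) (H : hilbertType R) n p
    (X : 'M[R]_(n, p)) (C : H -> H) (sigma : R) (b : 'I_p -> H)
    (y : 'I_n -> H) : R :=
  \int[product_prob (fun i => gaussian (mulmxH X b i) C)]_(z in [set: n.-tuple (borel H)])
    expR (- (sigma * \sum_(i < n) `|y i - (tnth z i : H)| ^+ 2)).

Definition is_mkm_estimate (R : realType) (H : hilbertType R) n p
    (X : 'M[R]_(n, p)) (C : H -> H) (sigma : R) (y : 'I_n -> H)
    (b : 'I_p -> H) : Prop :=
  forall b' : 'I_p -> H, kernel_mean X C sigma b' y <= kernel_mean X C sigma b y.

(* Main.v *)
Require Import Defs.
From mathcomp Require Import all_boot all_order all_algebra sesquilinear.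
From mathcomp Require Import all_classical all_reals all_analysis.
From mathcomp Require Import measurable_realfun ring lra.

(* Write [phi u] for the expectation of [expR (- sigma * |u - Z| ^+ 2)] with
   Z ~ N(0, C).  The product structure gives
   [kernel_mean b = \prod_i phi (y_i - x_i^T b)].  If Z' is an independent copy
   of Z, then ((Z + Z') / sqrt 2, (Z - Z') / sqrt 2) has the same law as (Z, Z'),
   and this rotation preserves the sum of the squared norms, whence
   [phi u * phi v = phi ((u + v) / sqrt 2) * phi ((u - v) / sqrt 2)].
   So [q u = ln (phi 0) - ln (phi u)] satisfies the parallelogram law.  It is
   nonnegative and bounded by [2 * sigma * |u| ^+ 2], hence (Jordan and von
   Neumann) it is the quadratic form of a symmetric real-bilinear form, and it is
   definite because [phi (t u)] tends to 0 for nonzero [u].  Maximizing the kernel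
   mean is thus minimizing [\sum_i q (y_i - x_i^T b)]: the normal equations make
   the cross terms with the residuals of [ols] vanish, whatever the form is.

   Equality of such expectations is reduced to one-dimensional marginals, without
   any uniqueness theorem for measures on H, by writing each factor
   [expR (- sigma * x ^+ 2)] as the average of [cos (g * x)] over g ~ N(0, 2 sigma)
   and exchanging the integrals, one coordinate of an orthonormal basis at
   a time. *)

Import Order.TTheory GRing.Theory Num.Theory.
Import numFieldNormedType.Exports.

Local Open Scope classical_set_scope.
Local Open Scope ring_scope.

Set Implicit Arguments.
Unset Strict Implicit.
Unset Printing Implicit Defensive.

(** * Integration *)

Section bounded_integrals.
Context d (T : measurableType d) (R : realType).
Implicit Types (P : probability T R) (f g : T -> R).

Lemma integrable_bounded P f (M : R) :
  measurable_fun [set: T] f -> (forall x, `|f x| <= M) ->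
  P.-integrable [set: T] (EFin \o f).
Proof.
move=> mf fM; apply: measurable_bounded_integrable => //.
  exact: le_lt_trans (probability_le1 P measurableT) (ltry _).
exists M; split; first exact: num_real.
by move=> y My x _; apply: le_trans (fM x) (ltW My).
Qed.

Lemma le_Rintegral_bounded P f g (M N : R) :
  measurable_fun [set: T] f -> measurable_fun [set: T] g ->
  (forall x, `|f x| <= M) -> (forall x, `|g x| <= N) ->
  (forall x, f x <= g x) -> \int[P]_x f x <= \int[P]_x g x.
Proof.
move=> mf mg fM gN fg; apply: le_Rintegral => //.
- exact: integrable_bounded fM.
- exact: integrable_bounded gN.
Qed.

Lemma cvg_Rintegral_bounded P (f_ : nat -> T -> R) f (M : R) :
  (forall n, measurable_fun [set: T] (f_ n)) -> measurable_fun [set: T] f ->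
  (forall n x, `|f_ n x| <= M) -> (forall x, f_ n x @[n --> \oo] --> f x) ->
  \int[P]_x f_ n x @[n --> \oo] --> \int[P]_x f x.
Proof.
move=> mf_ mf f_M f_f.
have [|||||_ _ H] := @dominated_convergence _ T R P setT measurableT
  (fun n => EFin \o f_ n) (EFin \o f) (cst M%:E).
- by move=> n; apply/measurable_EFinP.
- exact/measurable_EFinP.
- by apply: aeW => x _; apply/fine_cvgP; split; [exact: nearW|exact: f_f].
- have := @integrable_bounded P (cst M) `|M| (measurable_cst _) (fun=> lexx _).
  by apply: eq_integrable.
- by apply: aeW => x n _; rewrite /= lee_fin.
apply: fine_cvg; rewrite fineK; last first.
  apply: integrable_fin_num => //; apply: (@integrable_bounded _ _ M) => // x.
  by apply: (cvgr_to_le (cvg_norm (f_f x))); exact: nearW.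
exact: H.
Qed.

End bounded_integrals.

Section bounded_Fubini.
Context d1 d2 (T1 : measurableType d1) (T2 : measurableType d2) (R : realType).
Variables (P1 : probability T1 R) (P2 : probability T2 R).
Variables (f : T1 * T2 -> R) (M : R).
Hypothesis mf : measurable_fun [set: T1 * T2] f.
Hypothesis fM : forall z, `|f z| <= M.

Let intf : (P1 \x P2)%E.-integrable [set: T1 * T2] (EFin \o f).
Proof. exact: integrable_bounded fM. Qed.

Lemma Rintegral_prod1 :
  \int[(P1 \x P2)%E]_z f z = \int[P1]_x \int[P2]_y f (x, y).
Proof.
rewrite {1}/Rintegral -integral12_prod_meas1 //; congr fine.
apply: eq_integral => x _; rewrite /fubini_F /= fineK//.
apply: (@integrable_fin_num _ _ _ P2 setT) => //.
apply: (@integrable_bounded _ _ _ P2 (fun y => f (x, y)) M) => //.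
exact: measurableT_comp.
Qed.

Lemma Rintegral_prod2 :
  \int[(P1 \x P2)%E]_z f z = \int[P2]_y \int[P1]_x f (x, y).
Proof.
rewrite {1}/Rintegral -integral21_prod_meas1 //; congr fine.
apply: eq_integral => y _; rewrite /fubini_G /= fineK//.
apply: (@integrable_fin_num _ _ _ P1 setT) => //.
apply: (@integrable_bounded _ _ _ P1 (fun x => f (x, y)) M) => //.
exact: measurableT_comp.
Qed.

Lemma Rintegral_exchange :
  \int[P1]_x \int[P2]_y f (x, y) = \int[P2]_y \int[P1]_x f (x, y).
Proof. by rewrite -Rintegral_prod1 Rintegral_prod2. Qed.

End bounded_Fubini.

Section Lebesgue_line.
Context (R : realType).
Local Notation mu := (@lebesgue_measure R).

(** The fundamental theorem of calculus on growing intervals leaves only boundary terms; dominated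
    convergence with bound [|f|] passes to the whole line. It serves as integration by parts. *)
Lemma Rintegral_derivative_eq0 (F f : R -> R) :
  (forall x : R, is_derive x (1 : R) F (f x)) -> continuous f ->
  mu.-integrable [set: R] (EFin \o f) ->
  F n%:R @[n --> \oo] --> 0 -> F (- n%:R) @[n --> \oo] --> 0 ->
  \int[mu]_x f x = 0.
Proof.
move=> dF cf intf Fy FNy.
(* The successor keeps the interval nondegenerate at [n = 0]. *)
pose I n := `[- n.+1%:R, n.+1%:R]%classic : set R.
have mfI n : measurable_fun [set: R] (f \_ (I n)).
  apply/(measurable_restrictT _ _).1; first exact: measurable_itv.
  by apply: measurable_funTS; exact: continuous_measurable_fun.
have [|||||_ _] := @dominated_convergence _ _ R mu setT measurableT
  (fun n => EFin \o (f \_ (I n))) (EFin \o f) (fun x => `|f x|%:E).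
- by move=> n; apply/measurable_EFinP; exact: mfI.
- by apply/measurable_EFinP; exact: continuous_measurable_fun.
- apply: aeW => x _; apply: cvg_near_cst; near=> n.
  rewrite /= patchE mem_set// /I/= in_itv/= -ler_norml.
  rewrite (@le_trans _ _ n%:R)//; last by rewrite ler_nat.
  by near: n; exact: nbhs_infty_ger.
- exact: integrable_norm.
- apply: aeW => x n _; rewrite /= lee_fin patchE; case: ifPn => // _.
  by rewrite normr0.
rewrite [X in X @ _ --> _](_ : _ =
    fun n : nat => (F n.+1%:R - F (- n.+1%:R))%:E); last first.
  apply/funext => n.
  transitivity (\int[mu]_(x in I n) (f x)%:E)%E.
    by rewrite [RHS]integral_mkcond restrict_EFin.
  rewrite (@continuous_FTC2 _ f F)//.
  - by rewrite (@lt_trans _ _ 0)// oppr_lt0 ltr0n.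
  - exact: continuous_subspaceT.
  - have cF x : {for x, continuous F}.
      by apply: differentiable_continuous; apply/derivable1_diffP; case: (dF x).
    split; first by move=> x _; case: (dF x).
    + by apply: cvg_at_right_filter; exact: cF.
    + by apply: cvg_at_left_filter; exact: cF.
  - by move=> x _; rewrite derive1E; exact: derive_val.
suff H0 : (F n.+1%:R - F (- n.+1%:R))%:E @[n --> \oo] --> 0%E.
  by move=> H; rewrite /Rintegral (cvg_unique _ H H0).
apply: cvg_EFin; first exact: nearW.
rewrite -[X in _ --> X]subr0.
by apply: cvgB; [move: Fy|move: FNy]; rewrite -(cvg_shiftS (fun n => F _)).
Unshelve. all: by end_near. Qed.

End Lebesgue_line.

(** * Normal laws *)

Section normal_density.
Context (R : realType) (m s : R).
Hypothesis s0 : s != 0.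
Local Notation mu := (@lebesgue_measure R).
Local Notation w := (normal_pdf m s).

Lemma is_derive_normal_pdf (x : R) :
  is_derive x (1 : R) w (- (x - m) / s ^+ 2 * w x).
Proof.
rewrite normal_pdfE// /normal_fun.
pose g (y : R) := - (y - m) ^+ 2 / (s ^+ 2 *+ 2).
have dg : is_derive x (1 : R) g (- (x - m) / s ^+ 2).
  by rewrite /g; apply: is_derive_eq; rewrite /GRing.scale/=; field.
have de : is_derive x (1 : R) (expR \o g) (expR (g x) * (- (x - m) / s ^+ 2)).
  exact: is_derive1_comp.
apply: (@is_derive_eq _ _ _ _ _ _ _ _ (is_deriveZ (normal_peak s) de)).
by rewrite /GRing.scale/= /g; ring.
Qed.

(** The lower bound on [|u n|] covers both ends of the line, [n] and [- n], at once. *)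
Lemma cvg_normal_pdf_dvg (u : nat -> R) :
  (forall n, n%:R <= `|u n|) -> w (u n) @[n --> \oo] --> 0.
Proof.
move=> u_ge; rewrite normal_pdfE// /normal_fun.
have s2_gt0 : 0 < s ^+ 2 by rewrite exprn_even_gt0.
rewrite -[X in _ --> X](mulr0 (normal_peak s)); apply: cvgM; first exact: cvg_cst.
have Hz : (u n - m) ^+ 2 / (s ^+ 2 *+ 2) @[n --> \oo] --> +oo.
  apply/cvgryPge => A; near=> n.
  have nm : `|m| + 1 <= n%:R by near: n; exact: nbhs_infty_ger.
  have nA : `|m| + A * (s ^+ 2 *+ 2) <= n%:R by near: n; exact: nbhs_infty_ger.
  have um : n%:R - `|m| <= `|u n - m|.
    by rewrite (le_trans _ (lerB_dist _ _))// lerB.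
  rewrite ler_pdivlMr ?mulrn_wgt0// -[leRHS]real_normK ?num_real//.
  move: um nm nA; set a := `|u n - m|; nra.
have := cvg_comp _ _ Hz (@cvgr_expR R).
by apply: cvg_trans; apply: near_eq_cvg; apply: nearW => n /=; rewrite mulNr.
Unshelve. all: by end_near. Qed.

(** Doubling the standard deviation leaves a spare factor [expR (3 * y ^+ 2 / (8 * s ^+ 2))], with
    [y = x - m], which absorbs [|y|] up to the constant [|s|]. *)
Lemma integrable_abs_normal_pdf :
  mu.-integrable [set: R] (fun x => (`|x - m| * w x)%:E).
Proof.
have s20 : 2 * s != 0 by rewrite mulf_neq0.
have := @integrableZl _ _ _ mu _ measurableT
  (`|s| * normal_peak s / normal_peak (2 * s)) _ (integrable_normal_pdf m (2 * s)).
apply: le_integrable => //.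
  apply/measurable_EFinP; apply: measurable_funM; last exact: measurable_normal_pdf.
  by apply: measurableT_comp => //; exact: measurable_funB.
have ab0 (a b c : R) : 0 <= b -> `|a| * b <= c -> `| `|a| * b| <= `|c|.
  move=> b0 abc; have ab : 0 <= `|a| * b by rewrite mulr_ge0.
  by rewrite [leLHS]ger0_norm// (le_trans abc)// ler_norm.
move=> x _; rewrite -EFinM lee_fin; apply: ab0; first exact: normal_pdf_ge0.
rewrite !normal_pdfE// /normal_fun -!mulrA mulKf ?gt_eqF ?normal_peak_gt0//.
rewrite mulrCA [leRHS]mulrCA ler_wpM2l ?normal_peak_ge0//.
set y := x - m.
have -> : - y ^+ 2 / (s ^+ 2 *+ 2) =
    - (3 * y ^+ 2 / (8 * s ^+ 2)) + - y ^+ 2 / ((2 * s) ^+ 2 *+ 2).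
  by field.
rewrite expRD mulrA ler_wpM2r ?expR_ge0//.
rewrite expRN ler_pdivrMr ?expR_gt0//.
apply: (@le_trans _ _ (`|s| * (1 + 3 * y ^+ 2 / (8 * s ^+ 2)))); last first.
  by rewrite ler_wpM2l// expR_ge1Dx.
have s1 : 0 < `|s| by rewrite normr_gt0.
rewrite -[y ^+ 2]real_normK ?num_real// -[s ^+ 2]real_normK ?num_real//.
rewrite mulrDr mulr1 -subr_ge0.
move: s1; move: `|y| `|s| => a b b0.
(* Completing the square in [a] makes positivity visible. *)
have -> : b + b * (3 * a ^+ 2 / (8 * b ^+ 2)) - a =
   (3 * (a - 4 / 3 * b) ^+ 2 + 8 / 3 * b ^+ 2) / (8 * b).
  by field; rewrite gt_eqF.
apply: divr_ge0; last by rewrite mulr_ge0// ltW.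
by apply: addr_ge0; rewrite mulr_ge0 ?sqr_ge0.
Qed.

End normal_density.

Lemma measurable_cos (R : realType) : measurable_fun [set: R] (@cos R).
Proof. by apply: continuous_measurable_fun; exact: continuous_cos. Qed.

Lemma measurable_sin (R : realType) : measurable_fun [set: R] (@sin R).
Proof. by apply: continuous_measurable_fun; exact: continuous_sin. Qed.

Lemma normr_cos_le1 (R : realType) (x : R) : `|cos x| <= 1.
Proof. by rewrite ler_norml cos_geN1 cos_le1. Qed.

Lemma normr_sin_le1 (R : realType) (x : R) : `|sin x| <= 1.
Proof. by rewrite ler_norml sin_geN1 sin_le1. Qed.

(** * Characteristic function of a normal law, in real form *)

Section normal_characteristic.
Context (R : realType) (m s : R).
Hypothesis s0 : s != 0.
Local Notation mu := (@lebesgue_measure R).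
Local Notation w := (normal_pdf m s).

Let integrable_cos_sin (g : R -> R) : measurable_fun [set: R] g ->
  (forall x, `|g x| <= 1) -> mu.-integrable [set: R] (fun x => (g x * w x)%:E).
Proof.
move=> mg g1; have := integrable_normal_pdf m s; apply: le_integrable => //.
  apply/measurable_EFinP; apply: measurable_funM => //.
  exact: measurable_normal_pdf.
move=> x _; rewrite lee_fin normrM ler_piMl//.
Qed.

(** The free phase [a] lets a single cosine integral carry both the real and the imaginary part of
    the characteristic function. *)
Let phase (t a x : R) := t * (x - m) + a.

Let measurable_phase t a : measurable_fun [set: R] (phase t a).
Proof.
apply: measurable_funD => //; apply: measurable_funM => //.
exact: measurable_funB.
Qed.

Let cf (a t : R) := \int[mu]_x (cos (phase t a x) * w x).

Let dcf (a t : R) := \int[mu]_x (- (x - m) * sin (phase t a x) * w x).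

(** Differentiation under the integral sign; the dominating function [|x - m| * w x] does not depend
    on [t]. *)
Let is_derive_cf a (t : R) : is_derive t (1 : R) (cf a) (dcf a t).
Proof.
have dphase x (u : R) :
    is_derive u (1 : R) (fun u => cos (phase u a x) * w x)
      (- (x - m) * sin (phase u a x) * w x).
  rewrite /phase; apply: is_derive_eq.
  by rewrite /GRing.scale/=; ring.
have d1 u x : partial1of2 (fun u x => cos (phase u a x) * w x) u x =
    - (x - m) * sin (phase u a x) * w x.
  by rewrite partial1of2E; apply: derive_val.
have tI : `](t - 1), (t + 1)[%classic t.
  by rewrite /= in_itv/= ltrBlDr ltrDl ltr01.
have intf u : `](t - 1), (t + 1)[%classic u ->
    mu.-integrable [set: R] (EFin \o (fun x => cos (phase u a x) * w x)).
  move=> _; apply: integrable_cos_sin => [|x].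
    exact: (measurableT_comp (@measurable_cos R) (measurable_phase _ a)).
  exact: normr_cos_le1.
have derf u x : `](t - 1), (t + 1)[%classic u -> [set: R] x ->
    derivable (fun u => cos (phase u a x) * w x) u 1.
  by move=> _ _; case: (dphase x u).
have G0 x : 0 <= `|x - m| * w x by rewrite mulr_ge0// normal_pdf_ge0.
have Gub u x : `](t - 1), (t + 1)[%classic u -> [set: R] x ->
   `|partial1of2 (fun u x => cos (phase u a x) * w x) u x| <= `|x - m| * w x.
  move=> _ _; rewrite d1 !normrM normrN (ger0_norm (normal_pdf_ge0 _ _ _)).
  rewrite ler_wpM2r ?normal_pdf_ge0// ler_piMr//.
  exact: normr_sin_le1.
have intG := integrable_abs_normal_pdf m s0.
apply: DeriveDef.
  exact: (derivable_under_integral measurableT tI intf derf G0 intG Gub).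
rewrite -derive1E (differentiation_under_integral measurableT tI intf derf G0
  intG Gub).
by apply: eq_Rintegral => x _; rewrite d1.
Qed.

(* Integration by parts, using [w' x = - (x - m) / s ^+ 2 * w x]. *)
Let dcfE a t : dcf a t = - (s ^+ 2 * t) * cf a t.
Proof.
have s2 : s ^+ 2 != 0 by rewrite expf_neq0.
(* This is the derivative of [sin (phase t a x) * w x], which vanishes at both ends. *)
pose f x := t * (cos (phase t a x) * w x) +
  (s ^+ 2)^-1 * (- (x - m) * sin (phase t a x) * w x).
have int1 : mu.-integrable [set: R] (fun x => (cos (phase t a x) * w x)%:E).
  apply: integrable_cos_sin => [|x].
    exact: (measurableT_comp (@measurable_cos R) (measurable_phase _ a)).
  exact: normr_cos_le1.
have int2 : mu.-integrable [set: R]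
    (fun x => (- (x - m) * sin (phase t a x) * w x)%:E).
  have := integrable_abs_normal_pdf m s0; apply: le_integrable => //.
    apply/measurable_EFinP; apply: measurable_funM; last exact: measurable_normal_pdf.
    apply: measurable_funM; first by apply: measurableT_comp => //;
      exact: measurable_funB.
    exact: (measurableT_comp (@measurable_sin R) (measurable_phase _ a)).
  move=> x _; rewrite lee_fin !normrM normrN normr_id.
  rewrite ler_wpM2r// ler_piMr//.
  exact: normr_sin_le1.
have int1t : mu.-integrable [set: R] (fun x => (t * (cos (phase t a x) * w x))%:E).
  exact: (@integrableZl _ _ _ mu setT measurableT t _ int1).
have int2s : mu.-integrable [set: R]
    (fun x => ((s ^+ 2)^-1 * (- (x - m) * sin (phase t a x) * w x))%:E).
  exact: (@integrableZl _ _ _ mu setT measurableT _ _ int2).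
have : \int[mu]_x f x = 0.
  apply: (@Rintegral_derivative_eq0 _ (fun x => sin (phase t a x) * w x) f).
  - move=> x; have dw := is_derive_normal_pdf m s0 x.
    rewrite /phase /f; apply: is_derive_eq.
    by rewrite /GRing.scale/= /phase; field.
  - move=> x; apply: differentiable_continuous; apply/derivable1_diffP.
    have dw := is_derive_normal_pdf m s0 x.
    by rewrite /f /phase; apply: ex_derive.
  - exact: integrableD int1t int2s.
  - apply: norm_cvg0; apply: (@squeeze_cvgr _ _ _ _ (cst 0) (fun n => w n%:R)).
    + apply: nearW => n; rewrite normr_ge0/= normrM (ger0_norm (normal_pdf_ge0 _
      _ _)).
      by rewrite ler_piMl ?normal_pdf_ge0 ?normr_sin_le1.
    + exact: cvg_cst.
    + by apply: cvg_normal_pdf_dvg => // n; rewrite normr_nat.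
  - apply: norm_cvg0; apply: (@squeeze_cvgr _ _ _ _ (cst 0) (fun n => w (- n%:R))).
    + apply: nearW => n; rewrite normr_ge0/= normrM (ger0_norm (normal_pdf_ge0 _
      _ _)).
      by rewrite ler_piMl ?normal_pdf_ge0 ?normr_sin_le1.
    + exact: cvg_cst.
    + by apply: cvg_normal_pdf_dvg => // n; rewrite normrN normr_nat.
rewrite /f RintegralD//.
rewrite !RintegralZl// -/(cf a t) -/(dcf a t) => /eqP.
rewrite addr_eq0 => /eqP e.
by apply: (mulfI (invr_neq0 s2)); rewrite mulNr mulrN mulrA mulKf// e opprK.
Qed.

(** The linear differential equation [dcfE] is solved with the integrating factor
    [expR (s ^+ 2 * t ^+ 2 / 2)]; the initial value is [cos a]. *)
Let cfE a t : cf a t = cos a * expR (- (s ^+ 2 * t ^+ 2 / 2)).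
Proof.
pose F u := cf a u * expR (s ^+ 2 * u ^+ 2 / 2).
have : F t = F 0.
  apply: is_derive_0_is_cst => u; rewrite /F.
  have dc := is_derive_cf a u.
  pose g (u : R) := s ^+ 2 * u ^+ 2 / 2.
  have dg : is_derive u (1 : R) g (s ^+ 2 * u).
    by rewrite /g; apply: is_derive_eq; rewrite /GRing.scale/=; field.
  have de : is_derive u (1 : R) (expR \o g) (expR (g u) * (s ^+ 2 * u)).
    exact: is_derive1_comp.
  apply: (@is_derive_eq _ _ _ _ _ _ _ _ (is_deriveM dc de)).
  by rewrite /GRing.scale/= dcfE /g; ring.
rewrite /F expr0n/= mulr0 mul0r expR0 mulr1.
have -> : cf a 0 = cos a.
  rewrite /cf /phase; under eq_Rintegral do rewrite mul0r add0r.
  rewrite RintegralZl//; last exact: integrable_normal_pdf.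
  by rewrite /Rintegral integral_normal_pdf/= mulr1.
by move=> <-; rewrite expRN mulfK// gt_eqF ?expR_gt0.
Qed.

(** The Radon-Nikodym derivative agrees almost everywhere with [w], since both have the same
    integral over every measurable set. *)
Lemma integral_normal_prob (f : R -> \bar R) :
  (normal_prob m s).-integrable [set: R] f ->
  (\int[normal_prob m s]_x f x = \int[mu]_x (f x * (w x)%:E))%E.
Proof.
move=> intf.
rewrite -(Radon_Nikodym_change_of_variables (normal_prob_dominates m s))//.
apply: ae_eq_integral => //.
- apply: emeasurable_funM; first exact: measurable_int intf.
  by apply: (measurable_int mu); apply: Radon_Nikodym_integrable;
    exact: normal_prob_dominates.
- apply: emeasurable_funM; first exact: measurable_int intf.
  by apply/measurable_EFinP; exact: measurable_normal_pdf.
apply: ae_eqe_mul2l; apply: integral_ae_eq => //.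
- by apply: Radon_Nikodym_integrable; exact: normal_prob_dominates.
- by apply/measurable_EFinP; exact: measurable_normal_pdf.
- move=> E _ mE; rewrite -Radon_Nikodym_integral//.
  exact: normal_prob_dominates.
Qed.

Lemma Rintegral_normal_prob_cos (t a : R) :
  \int[normal_prob m s]_x cos (t * (x - m) + a) =
  cos a * expR (- (s ^+ 2 * t ^+ 2 / 2)).
Proof.
rewrite -cfE /cf /Rintegral integral_normal_prob//.
apply: (@integrable_bounded _ _ _ (normal_prob m s)
  (fun x => cos (t * (x - m) + a)) 1) => [|x]; last exact: normr_cos_le1.
exact: (measurableT_comp (@measurable_cos R) (measurable_phase _ a)).
Qed.

End normal_characteristic.

Section normal_law.
Context (R : realType).
Local Notation mu := (@lebesgue_measure R).

(** By uniqueness of Lebesgue measure, it suffices to compare lengths of half-open intervals. *)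
Lemma lebesgue_measure_shift (c : R) (A : set R) : measurable A ->
  mu ((fun x => x + c) @^-1` A) = mu A.
Proof.
move=> mA.
have mc : measurable_fun [set: measurableTypeR R]
    ((fun x => x + c) : measurableTypeR R -> measurableTypeR R).
  exact: measurable_funD.
pose nu : {measure set (measurableTypeR R) -> \bar R} :=
  measure_function_pushforward__canonical__measure_function_Measure mu mc.
apply/esym; apply: (@lebesgue_measure_unique R nu) => // X [[a b] _ <-].
rewrite /nu /= /pushforward.
rewrite (_ : _ @^-1` _ = `]a - c, b - c]%classic); last first.
  by apply/seteqP; split => x /=; rewrite !in_itv/= ltrBlDr lerBrDr.
rewrite !lebesgue_measure_itv/= !lte_fin ltrD2r; case: ifPn => // _.
by rewrite -!EFinB; congr EFin; ring.
Qed.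

Lemma normal_prob_shift (m s c : R) (B : set R) : s != 0 -> measurable B ->
  normal_prob m s ((fun x => x + c) @^-1` B) = normal_prob (m + c) s B.
Proof.
move=> s0 mB; rewrite /normal_prob.
have mc : measurable_fun [set: measurableTypeR R]
    ((fun x => x + c) : measurableTypeR R -> measurableTypeR R).
  exact: measurable_funD.
rewrite [RHS](@eq_measure_integral _ _ _ _
  (measure_function_pushforward__canonical__measure_function_Measure mu mc));
  last by move=> A mA _; rewrite -[LHS](lebesgue_measure_shift c).
rewrite (ge0_integral_pushforward mc mu mB)//.
- apply: eq_integral => x _ /=; congr EFin.
  by rewrite !normal_pdfE// /normal_fun opprD addrACA subrr addr0.
- apply: measurable_funTS; apply/measurable_EFinP.
  exact: measurable_normal_pdf.
- by move=> x _; rewrite lee_fin normal_pdf_ge0.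
Qed.

Lemma normal_law_shift (m v c : R) (B : set R) : 0 <= v -> measurable B ->
  normal_law m v ((fun x => x + c) @^-1` B) = normal_law (m + c) v B.
Proof.
move=> v0 mB; rewrite /normal_law; case: eqVneq => [_|vN0].
  by rewrite /dirac/= /indic; congr (_ %:R%:E); congr nat_of_bool; apply/idP/idP;
    rewrite !inE.
by rewrite normal_prob_shift// gt_eqF// sqrtr_gt0 lt_neqAle eq_sym vN0.
Qed.

Lemma Rintegral_cos_normal_law d (T : measurableType d) (P : probability T R)
    (X : T -> R) (m v c : R) : measurable_fun [set: T] X -> 0 <= v ->
  (forall B : set R, measurable B -> pushforward P X B = normal_law m v B) ->
  \int[P]_x cos (X x + c) = cos (m + c) * expR (- (v / 2)).
Proof.
move=> mX v0 lawX.
have mcos : measurable_fun [set: R] (fun x : R => cos (x + c)).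
  by apply: (measurableT_comp (@measurable_cos R)); exact: measurable_funD.
have intX : P.-integrable [set: T] (fun x => (cos (X x + c))%:E).
  apply: (@integrable_bounded _ _ _ _ (fun x => cos (X x + c)) 1) => [|x].
    exact: measurableT_comp mcos mX.
  exact: normr_cos_le1.
rewrite /Rintegral.
pose X' : T -> measurableTypeR R := X.
have mX' : measurable_fun [set: T] X' by exact: mX.
rewrite -(@integral_pushforward _ _ _ _ _ X' mX' P setT (fun x =>
  (cos (x + c))%:E))//; last first.
  exact/measurable_EFinP.
rewrite /normal_law in lawX; move: lawX; case: (eqVneq v 0) => [->|vN0] lawX.
  rewrite (eq_measure_integral (dirac (m : measurableTypeR R))).
    rewrite integral_dirac//; last exact/measurable_EFinP.
    by rewrite diracT mul1e /= mul0r oppr0 expR0 mulr1.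
  by move=> B mB _; exact: lawX.
have s0 : Num.sqrt v != 0.
  by rewrite gt_eqF// sqrtr_gt0 lt_neqAle eq_sym vN0.
transitivity (\int[normal_prob m (Num.sqrt v)]_x cos (x + c)).
  congr fine; apply: (@eq_measure_integral _ _ _ _ (normal_prob m (Num.sqrt v))
    (measure_function_pushforward__canonical__measure_function_Measure P mX')).
  by move=> B mB _; exact: lawX.
(* Frequency 1 and phase [m + c] undo the centering: [(x - m) + (m + c) = x + c]. *)
have := Rintegral_normal_prob_cos m s0 1 (m + c).
rewrite sqr_sqrtr// expr1n mulr1 => <-.
by apply: eq_Rintegral => x _; congr cos; ring.
Qed.

End normal_law.

(** * Gaussian mixtures *)

Section Gaussian_mixture.
Context d (T : measurableType d) (R : realType) (P : probability T R).
Context (V : lmodType R) (L : V -> T -> R) (sigma : R).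
Hypothesis mL : forall a, measurable_fun [set: T] (L a).
Hypothesis linL : forall a b y z, L (a + y *: b) z = L a z + y * L b z.
Hypothesis sigma0 : 0 < sigma.

(** The Gaussian kernel truncated to [k] coordinates. The coordinates come from an abstract linear
    family [L], so that pairs of Hilbert-valued variables are covered too. *)
Definition kernel_part (e : nat -> V) (k : nat) (z : T) : R :=
  expR (- (sigma * \sum_(j < k) L (e j) z ^+ 2)).

Lemma measurable_kernel_part e k : measurable_fun [set: T] (kernel_part e k).
Proof.
apply: measurableT_comp => //; apply: measurableT_comp => //.
apply: measurable_funM => //; apply: measurable_sum => j.
exact: measurable_funX.
Qed.

Lemma kernel_part_ge0 e k z : 0 <= kernel_part e k z.
Proof. exact: expR_ge0. Qed.

Lemma kernel_part_le1 e k z : kernel_part e k z <= 1.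
Proof.
rewrite -expR0 ler_expR oppr_le0 mulr_ge0 ?(ltW sigma0)// sumr_ge0// => j _.
exact: sqr_ge0.
Qed.

(* [expR (- sigma * x ^+ 2)] is the characteristic function of N(0, 2 sigma). *)
Lemma Rintegral_kernel_partS e k a :
  \int[P]_z (kernel_part e k.+1 z * cos (L a z)) =
  \int[normal_prob 0 (Num.sqrt (2 * sigma))]_y
    \int[P]_z (kernel_part e k z * cos (L (a + y *: e k) z)).
Proof.
have s0 : Num.sqrt (2 * sigma) != 0.
  by rewrite gt_eqF// sqrtr_gt0 mulr_gt0.
pose N : probability (measurableTypeR R) R := normal_prob 0 (Num.sqrt (2 * sigma)).
pose f (w : T * measurableTypeR R) := kernel_part e k w.1 * cos (L a w.1 +
  w.2 * L (e k) w.1).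
have mf : measurable_fun [set: T * measurableTypeR R] f.
  apply: measurable_funM; first exact: (measurableT_comp (measurable_kernel_part
    e k) measurable_fst).
  apply: (measurableT_comp (@measurable_cos R)); apply: measurable_funD.
    exact: (measurableT_comp (mL a) measurable_fst).
  apply: measurable_funM; first exact: measurable_snd.
  exact: (measurableT_comp (mL (e k)) measurable_fst).
have f1 w : `|f w| <= 1.
  rewrite normrM ger0_norm ?kernel_part_ge0// mulr_ile1 ?kernel_part_ge0//.
    exact: kernel_part_le1.
  exact: normr_cos_le1.
transitivity (\int[P]_z \int[N]_y f (z, y)).
  apply: eq_Rintegral => z _; rewrite /f/= RintegralZl//; last first.
    apply: (@integrable_bounded _ _ _ N (fun y =>
      cos (L a z + y * L (e k) z)) 1) => [|y]; last exact: normr_cos_le1.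
    by apply: (measurableT_comp (@measurable_cos R));
      apply: measurable_funD => //; apply: measurable_funM.
  have := Rintegral_normal_prob_cos 0 s0 (L (e k) z) (L a z).
  rewrite sqr_sqrtr ?mulr_ge0 ?(ltW sigma0)// => E.
  transitivity (kernel_part e k z *
    (cos (L a z) * expR (- (2 * sigma * L (e k) z ^+ 2 / 2)))).
    rewrite /kernel_part big_ord_recr/= mulrDr opprD expRD.
    have -> : 2 * sigma * L (e k) z ^+ 2 / 2 = sigma * L (e k) z ^+ 2 by field.
    by ring.
  rewrite -E; congr (_ * _); apply: eq_Rintegral => y _.
  by rewrite subr0 addrC [in RHS]mulrC.
rewrite (Rintegral_exchange P N mf f1).
by apply: eq_Rintegral => y _; apply: eq_Rintegral => z _; rewrite /f/= linL.
Qed.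

End Gaussian_mixture.

(** The truncated kernel is a mixture of cosines of linear observables, so its mean depends on the
    law only through their cosine integrals. *)
Lemma Rintegral_kernel_part_eq (R : realType) (V : lmodType R)
    d (T : measurableType d) (P : probability T R) (L : V -> T -> R)
    d' (T' : measurableType d') (P' : probability T' R) (L' : V -> T' -> R)
    (sigma : R) (e : nat -> V) (k : nat) :
  (forall a, measurable_fun [set: T] (L a)) ->
  (forall a b y z, L (a + y *: b) z = L a z + y * L b z) ->
  (forall a, measurable_fun [set: T'] (L' a)) ->
  (forall a b y z, L' (a + y *: b) z = L' a z + y * L' b z) ->
  (forall a, \int[P]_z cos (L a z) = \int[P']_z cos (L' a z)) ->
  0 < sigma ->
  \int[P]_z kernel_part L sigma e k z = \int[P']_z kernel_part L' sigma e k z.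
Proof.
move=> mL linL mL' linL' LL' sigma0.
have L0 z : L 0 z = 0.
  by apply/(addrI (L 0 z)); rewrite -{2}[L 0 z]mul1r -linL scaler0 !addr0.
have L'0 z : L' 0 z = 0.
  by apply/(addrI (L' 0 z)); rewrite -{2}[L' 0 z]mul1r -linL' scaler0 !addr0.
(* The cosine factor strengthens the induction: each step trades the last coordinate for a change of
   [a]. The case [a = 0] gives the claim. *)
suff H a : \int[P]_z (kernel_part L sigma e k z * cos (L a z)) =
           \int[P']_z (kernel_part L' sigma e k z * cos (L' a z)).
  have := H 0.
  under eq_Rintegral do rewrite L0 cos0 mulr1.
  by under [X in _ = X]eq_Rintegral do rewrite L'0 cos0 mulr1.
elim: k a => [|k IH] a.
  rewrite /kernel_part.
  under eq_Rintegral do rewrite big_ord0 mulr0 oppr0 expR0 mul1r.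
  by under [RHS]eq_Rintegral do rewrite big_ord0 mulr0 oppr0 expR0 mul1r.
rewrite (Rintegral_kernel_partS P mL linL sigma0)
  (Rintegral_kernel_partS P' mL' linL' sigma0).
by apply: eq_Rintegral => y _; exact: IH.
Qed.

(** * Hilbert spaces *)

Section Hilbert_space.
Context (R : realType) (H : hilbertType R).
Implicit Types (x y z : H).

Lemma innerC x y : inner x y = inner y x.
Proof. by rewrite hermC expr0 mul1r. Qed.

Lemma innerDl x y z : inner (x + y) z = inner x z + inner y z.
Proof. exact: linearDl. Qed.

Lemma innerDr x y z : inner z (x + y) = inner z x + inner z y.
Proof. exact: linearDr. Qed.

Lemma innerZl (a : R) x y : inner (a *: x) y = a * inner x y.
Proof. exact: linearZl_LR. Qed.

Lemma innerZr (a : R) x y : inner x (a *: y) = a * inner x y.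
Proof. by rewrite innerC innerZl innerC. Qed.

Lemma innerNl x y : inner (- x) y = - inner x y.
Proof. exact: linearNl. Qed.

Lemma innerNr x y : inner x (- y) = - inner x y.
Proof. by rewrite innerC innerNl innerC. Qed.

Lemma innerBl x y z : inner (x - y) z = inner x z - inner y z.
Proof. exact: linearBl. Qed.

Lemma innerBr x y z : inner z (x - y) = inner z x - inner z y.
Proof. exact: linearBr. Qed.

Lemma inner0l x : inner 0 x = 0.
Proof. exact: linear0l. Qed.

Lemma inner_suml (I : Type) (r : seq I) (P : pred I) (F : I -> H) x :
  inner (\sum_(i <- r | P i) F i) x = \sum_(i <- r | P i) inner (F i) x.
Proof. exact: linear_sumlz. Qed.

Lemma inner_sumr (I : Type) (r : seq I) (P : pred I) (F : I -> H) x :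
  inner x (\sum_(i <- r | P i) F i) = \sum_(i <- r | P i) inner x (F i).
Proof. exact: linear_sumr. Qed.

Lemma sqr_normD x y : `|x + y| ^+ 2 = `|x| ^+ 2 + 2 * inner x y + `|y| ^+ 2.
Proof. by rewrite -!inner_norm innerDl !innerDr (innerC y x); ring. Qed.

Lemma sqr_normB x y : `|x - y| ^+ 2 = `|x| ^+ 2 - 2 * inner x y + `|y| ^+ 2.
Proof. by rewrite -!inner_norm innerBl !innerBr (innerC y x); ring. Qed.

(* Polarization makes continuity of the inner product follow from that of the norm. *)
Lemma continuous_inner (a : H) : continuous (inner a).
Proof.
move=> x; rewrite /continuous_at.
have E z : inner a z = (`|a + z| ^+ 2 - `|a| ^+ 2 - `|z| ^+ 2) / 2.
  by rewrite sqr_normD; field.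
rewrite [X in X @ _](_ : _ = fun z =>
  (`|a + z| ^+ 2 - `|a| ^+ 2 - `|z| ^+ 2) / 2); last exact/funext.
have sqr_cvg (f : H -> R) (l : R) : f z @[z --> x] --> l -> f z ^+ 2 @[z --> x]
  --> l ^+ 2.
  by move=> fl; exact: (cvg_comp _ _ fl (@exprn_continuous R 2 l)).
rewrite E; apply: cvgM; last exact: cvg_cst.
apply: cvgB; last by apply: sqr_cvg; apply: cvg_norm; exact: cvg_id.
apply: cvgB; last exact: cvg_cst.
by apply: sqr_cvg; apply: cvg_norm; apply: cvgD; [exact: cvg_cst|exact: cvg_id].
Qed.

(** Bessel's inequality makes the squared coefficients summable, so the Fourier series is Cauchy and
    converges by completeness. Its limit has the coefficients of [x], hence equals [x] by totality
    of [e]. *)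
Lemma parseval (e : nat -> H) x : orthonormal_basis e ->
  \sum_(j < k) inner x (e j) ^+ 2 @[k --> \oo] --> `|x| ^+ 2.
Proof.
move=> [ortho total].
pose c j := inner x (e j).
pose S := series (fun j => c j *: e j).
have inner_sum (m n : nat) y : inner (\sum_(m <= j < n) c j *: e j) y =
    \sum_(m <= j < n) c j * inner (e j) y.
  by rewrite inner_suml; apply: eq_bigr => j _; rewrite innerZl.
have inner_sum_e (m n i : nat) : (m <= i < n)%N ->
    inner (\sum_(m <= j < n) c j *: e j) (e i) = c i.
  move=> min; rewrite inner_sum (bigD1_seq i)/= ?mem_index_iota ?iota_uniq//.
  rewrite ortho eqxx mulr1 big1 ?addr0// => j ji.
  by rewrite ortho (negbTE ji) mulr0.
have norm_sum (m n : nat) : `|\sum_(m <= j < n)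
  c j *: e j| ^+ 2 = \sum_(m <= j < n) c j ^+ 2.
  rewrite -inner_norm inner_sumr big_nat [RHS]big_nat; apply: eq_bigr => j mjn.
  by rewrite innerZr inner_sum_e// expr2.
have A_le n : \sum_(0 <= j < n) c j ^+ 2 <= `|x| ^+ 2.
  have := sqr_ge0 `|x - S n|; rewrite sqr_normB norm_sum.
  have -> : inner x (S n) = \sum_(0 <= j < n) c j ^+ 2.
    by rewrite inner_sumr; apply: eq_bigr => j _; rewrite innerZr -expr2.
  lra.
have cvgA : cvgn (series (fun j => c j ^+ 2)).
  apply: nondecreasing_is_cvgn.
    by apply: nondecreasing_series => j _ _; exact: sqr_ge0.
  by exists (`|x| ^+ 2) => _ [n _ <-]; exact: A_le.
have cvgS : cvgn S.
  apply: cauchy_cvg; apply/cauchy_seriesP => eps eps0.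
  move: cvgA => /cvg_cauchy/cauchy_seriesP/(_ _ (exprn_gt0 2 eps0)).
  apply: filterS => -[m n] /=; rewrite -norm_sum => mn.
  rewrite -(@ltr_pXn2r _ 2)// ?nnegrE ?(ltW eps0)//.
  by apply: le_lt_trans mn; rewrite ler_norm.
move/cvg_ex : cvgS => [s cvgS].
have xs : x = s.
  apply/subr0_eq/total => i; apply/eqP; rewrite innerBl subr_eq0; apply/eqP.
  rewrite [RHS]innerC.
  have lim1 : inner (e i) (S n) @[n --> \oo] --> inner (e i) s.
    exact: (cvg_comp _ _ cvgS (@continuous_inner (e i) s)).
  suff lim2 : inner (e i) (S n) @[n --> \oo] --> inner x (e i).
    exact: (cvg_unique _ lim2 lim1).
  apply: cvg_near_cst; near=> n.
  rewrite /= innerC inner_sum_e//=.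
  by near: n; exact: nbhs_infty_gt.
have lim : `|S n| ^+ 2 @[n --> \oo] --> `|x| ^+ 2.
  rewrite xs; apply: (cvg_comp (fun n => `|S n|) (fun t : R => t ^+ 2)).
    by apply: cvg_norm; exact: cvgS.
  exact: exprn_continuous.
apply: cvg_trans lim; apply: near_eq_cvg; apply: nearW => n /=.
by rewrite norm_sum big_mkord.
Unshelve. all: by end_near. Qed.

End Hilbert_space.

Section Borel_Hilbert.
Context (R : realType) (H : hilbertType R).

Lemma measurable_continuous_borel (f : H -> R) : continuous f ->
  measurable_fun [set: borel H] (f : borel H -> R).
Proof.
move=> /continuousP cf; apply: (measurability _ (RGenOpens.measurableE R)).
move=> _ [_ [a [b ->] <-]]; rewrite setTI; apply: sub_sigma_algebra.
by apply: cf; exact: interval_open.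
Qed.

Lemma measurable_borel_shift (a : H) :
  measurable_fun [set: borel H] ((fun z : H => z + a) : borel H -> borel H).
Proof.
set f : borel H -> borel H := fun z => _.
apply: (@measurability _ _ (borel H) (borel H) setT f (@open H)) => //.
move=> _ [B oB <-]; rewrite setTI; apply: sub_sigma_algebra.
apply: open_comp => // z _.
by apply: cvgD; [exact: cvg_id|exact: cvg_cst].
Qed.

End Borel_Hilbert.

(** * Comparison of kernel expectations through cosine integrals *)

Section kernel_comparison.
Context (R : realType) (H : hilbertType R) (sigma : R) (e : nat -> H).
Hypothesis sigma0 : 0 < sigma.
Hypothesis basis_e : orthonormal_basis e.

(** An orthonormal basis of the Hilbert sum of two copies of [H]: the first [k.*2] vectors give [k]
    coordinates of each component. *)
Definition pair_basis j : (H * H)%type := if odd j then (0, e j./2) else (e j./2, 0).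

Definition pairing d (T : measurableType d) (x1 x2 : T -> H) (ab : (H * H)%type) z :=
  inner ab.1 (x1 z) + inner ab.2 (x2 z).

(** Parseval in each component gives pointwise convergence, and the kernels are bounded by 1. *)
Lemma cvg_kernel_pairing d (T : measurableType d) (P : probability T R)
    (x1 x2 : T -> H) :
  (forall a, measurable_fun [set: T] (fun z => inner a (x1 z))) ->
  (forall a, measurable_fun [set: T] (fun z => inner a (x2 z))) ->
  \int[P]_z kernel_part (pairing x1 x2) sigma pair_basis k.*2 z @[k --> \oo] -->
  \int[P]_z expR (- (sigma * (`|x1 z| ^+ 2 + `|x2 z| ^+ 2))).
Proof.
move=> mx1 mx2.
have mp ab : measurable_fun [set: T] (pairing x1 x2 ab) by exact: measurable_funD.
have sumE k z : \sum_(j < k.*2) pairing x1 x2 (pair_basis j) z ^+ 2 =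
    \sum_(j < k) inner (x1 z) (e j) ^+ 2 + \sum_(j < k) inner (x2 z) (e j) ^+ 2.
  elim: k => [|k IH]; first by rewrite !big_ord0 addr0.
  rewrite doubleS !big_ord_recr/= IH /pairing /pair_basis /= odd_double/=
    uphalf_double doubleK.
  by rewrite !inner0l addr0 add0r (innerC (e k)) (innerC (e k)); ring.
have cvg_z z : kernel_part (pairing x1 x2) sigma pair_basis k.*2 z @[k --> \oo] -->
    expR (- (sigma * (`|x1 z| ^+ 2 + `|x2 z| ^+ 2))).
  apply: (cvg_comp _ expR); last exact: continuous_expR.
  apply: cvgN; apply: cvgM; first exact: cvg_cst.
  under eq_fun do rewrite sumE.
  by apply: cvgD; exact: parseval.
apply: (@cvg_Rintegral_bounded _ _ _ _ _ _ 1) => //.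
- by move=> k; exact: measurable_kernel_part.
- apply: measurable_fun_cvg => [k|z _]; last exact: cvg_z.
  exact: measurable_kernel_part.
- move=> k z; rewrite ger0_norm ?kernel_part_ge0//.
  exact: kernel_part_le1.
Qed.

(** The truncated expectations agree for every [k], hence so do their limits. *)
Lemma Rintegral_kernel_eq d (T : measurableType d) (P : probability T R)
    (x1 x2 : T -> H) d' (T' : measurableType d') (P' : probability T' R)
    (x1' x2' : T' -> H) :
  (forall a, measurable_fun [set: T] (fun z => inner a (x1 z))) ->
  (forall a, measurable_fun [set: T] (fun z => inner a (x2 z))) ->
  (forall a, measurable_fun [set: T'] (fun z => inner a (x1' z))) ->
  (forall a, measurable_fun [set: T'] (fun z => inner a (x2' z))) ->
  (forall a b, \int[P]_z cos (inner a (x1 z) + inner b (x2 z)) =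
               \int[P']_z cos (inner a (x1' z) + inner b (x2' z))) ->
  \int[P]_z expR (- (sigma * (`|x1 z| ^+ 2 + `|x2 z| ^+ 2))) =
  \int[P']_z expR (- (sigma * (`|x1' z| ^+ 2 + `|x2' z| ^+ 2))).
Proof.
move=> mx1 mx2 mx1' mx2' cosE.
have lin d0 (T0 : measurableType d0) (w1 w2 : T0 -> H) a b y z :
    pairing w1 w2 (a + y *: b) z = pairing w1 w2 a z + y * pairing w1 w2 b z.
  by rewrite /pairing /= !innerDl !innerZl; ring.
have cvg1 := @cvg_kernel_pairing _ _ P _ _ mx1 mx2.
have cvg2 := @cvg_kernel_pairing _ _ P' _ _ mx1' mx2'.
suff E : (fun k => \int[P]_z kernel_part (pairing x1 x2) sigma pair_basis k.*2 z) =
    (fun k => \int[P']_z kernel_part (pairing x1' x2') sigma pair_basis k.*2 z).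
  by rewrite E in cvg1; exact: (cvg_unique _ cvg1 cvg2).
apply/funext => k; apply: Rintegral_kernel_part_eq => //.
- by move=> ab; exact: measurable_funD.
- by move=> ab; exact: measurable_funD.
- by move=> [a b]; exact: cosE.
Qed.

End kernel_comparison.

(** * Gaussian measures and the smoothed kernel *)

Section Gaussian_measures.
Context (R : realType) (H : hilbertType R) (C : {linear H -> H}).
Hypothesis HC : covariance_operator C.

Lemma covariance_ge0 a : 0 <= inner (C a) a.
Proof. by case: HC. Qed.

Lemma measurable_inner (a : H) :
  measurable_fun [set: borel H] (fun z : borel H => inner a (z : H)).
Proof. by apply: measurable_continuous_borel; exact: continuous_inner. Qed.

Lemma Rintegral_cos_gaussian (Q : probability (borel H) R) (mu a : H) (c : R) :
  is_gaussian Q mu C ->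
  \int[Q]_z cos (inner a (z : H) + c) =
  cos (inner a mu + c) * expR (- (inner (C a) a / 2)).
Proof.
move=> gQ; apply: Rintegral_cos_normal_law; first exact: measurable_inner.
- exact: covariance_ge0.
- exact: gQ.
Qed.

Lemma is_gaussian_shift (Q : probability (borel H) R) (mu nu : H) :
  is_gaussian Q mu C ->
  is_gaussian (distribution Q (mfun_Sub (mem_set (measurable_borel_shift nu))
    : {RV Q >-> borel H})) (mu + nu) C.
Proof.
move=> gQ a B mB.
rewrite innerDr -normal_law_shift ?covariance_ge0// -gQ//; last first.
  by rewrite -[X in measurable X]setTI; exact: measurable_funD.
rewrite /pushforward /distribution/= /pushforward/=; congr (Q _).
by apply/seteqP; split => z /=; rewrite innerDr.
Qed.

(** The translate of the centered law [Q] witnesses existence, so the choice made by [xget] is a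
    genuine Gaussian law and not the default. *)
Lemma gaussianP (Q : probability (borel H) R) (mu : H) :
  is_gaussian Q 0 C -> is_gaussian (gaussian mu C) mu C.
Proof.
move=> /(is_gaussian_shift mu); rewrite add0r => gQ.
by apply: (xgetPex (dirac (0 : borel H) : pprobability (borel H) R)
  (P := [set Q : pprobability (borel H) R | is_gaussian Q mu C])); eexists; exact: gQ.
Qed.

End Gaussian_measures.

Section Gaussian_kernel.
Context (R : realType) (H : hilbertType R) (C : {linear H -> H}).
Hypothesis HC : covariance_operator C.
Context (sigma : R) (Q : probability (borel H) R).
Hypothesis sigma0 : 0 < sigma.
Hypothesis gQ : is_gaussian Q 0 C.

(** The convolution of [P] with the Gaussian kernel; [smoothing Q] is the function written [phi]. *)
Definition smoothing (P : probability (borel H) R) (u : H) : R :=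
  \int[P]_z expR (- (sigma * `|u - (z : H)| ^+ 2)).

Local Notation phi := (smoothing Q).

Lemma measurable_sqdist_kernel (u : H) :
  measurable_fun [set: borel H] (fun z : borel H =>
    expR (- (sigma * `|u - (z : H)| ^+ 2))).
Proof.
apply: measurable_continuous_borel => z.
apply: (cvg_comp (fun z : H => - (sigma * `|u - z| ^+ 2)) expR);
  last exact: continuous_expR.
apply: cvgN; apply: cvgM; first exact: cvg_cst.
apply: (cvg_comp (fun z : H => `|u - z|) (fun t : R => t ^+ 2));
  last exact: exprn_continuous.
by apply: cvg_norm; apply: cvgB; [exact: cvg_cst|exact: cvg_id].
Qed.

Lemma normr_kernel_le1 (x : H) : `|expR (- (sigma * `|x| ^+ 2))| <= 1.
Proof.
rewrite ger0_norm ?expR_ge0// -expR0 ler_expR oppr_le0.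
by rewrite mulr_ge0 ?(ltW sigma0)// sqr_ge0.
Qed.

(** The variable [y - Z] under [P] and [y - mu - Z] under [Q] have the same cosine integrals. Hence
    any measure with the prescribed marginals gives the same value. *)
Lemma smoothing_shift (P : probability (borel H) R) (mu y : H) :
  is_gaussian P mu C -> smoothing P y = phi (y - mu).
Proof.
move=> gP; have [_ _ _ [e basis_e _]] := HC.
pose x1 (z : borel H) : H := y - (z : H).
pose x1' (z : borel H) : H := y - mu - (z : H).
(* A zero second component reduces the one-variable comparison to the one for pairs. *)
pose x2 (z : borel H) : H := 0.
have mx (w : H) (a : H) : measurable_fun [set: borel H] (fun z : borel H =>
  inner a (w - (z : H))).
  under eq_fun do rewrite innerBr.
  by apply: measurable_funB => //; exact: measurable_inner.
have mx2 (a : H) : measurable_fun [set: borel H] (fun z : borel H => inner a (x2 z)).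
  exact: (measurable_cst (inner a (0 : H))).
have smooth_x2 (P' : probability (borel H) R) w :
    smoothing P' w =
    \int[P']_z expR (- (sigma * (`|w - (z : H)| ^+ 2 + `|x2 z| ^+ 2))).
  by apply: eq_Rintegral => z _; rewrite /x2 normr0 expr0n addr0.
rewrite !smooth_x2.
apply: (Rintegral_kernel_eq sigma0 basis_e (x1 := x1) (x1' := x1')
  (x2 := x2) (x2' := x2)) => //.
- exact: mx.
- exact: mx.
- move=> a b.
  have E w (z : H) : inner a (w - z) + inner b 0 = inner (- a) z + inner a w.
    by rewrite innerBr innerNl (innerC b) inner0l addr0 addrC.
  rewrite /x1 /x1' /x2.
  under eq_Rintegral do rewrite E.
  under [RHS]eq_Rintegral do rewrite E.
  rewrite (Rintegral_cos_gaussian HC _ _ gP) (Rintegral_cos_gaussian HC _ _ gQ).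
  by congr (cos _ * _); rewrite (innerC _ 0) inner0l innerBr innerNl; ring.
Qed.

Lemma measurable_inner_pair (a b : H) (c : R) :
  measurable_fun [set: borel H * borel H]
    (fun z => inner a (z.1 : H) + inner b (z.2 : H) + c).
Proof.
apply: measurable_funD => //; apply: measurable_funD.
  exact: (measurableT_comp (measurable_inner a) measurable_fst).
exact: (measurableT_comp (measurable_inner b) measurable_snd).
Qed.

(** Fubini, one variable at a time: while one is integrated, the other is part of the phase. *)
Lemma Rintegral_cos_gaussian2 (a b : H) (c : R) :
  \int[(Q \x Q)%E]_z cos (inner a (z.1 : H) + inner b (z.2 : H) + c) =
  cos c * expR (- ((inner (C a) a + inner (C b) b) / 2)).
Proof.
rewrite (@Rintegral_prod1 _ _ _ _ _ Q Q _ 1) => [||z]; last exact: normr_cos_le1.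
  transitivity (\int[Q]_z (cos (inner a (z : H) + c) * expR (- (inner (C b) b / 2)))).
    apply: eq_Rintegral => z _ /=.
    have := Rintegral_cos_gaussian HC b (inner a (z : H) + c) gQ.
    rewrite [inner b 0]innerC inner0l add0r => <-.
    by apply: eq_Rintegral => w _; congr cos; ring.
  rewrite RintegralZr//; last first.
    apply: (@integrable_bounded _ _ _ _ (fun z : borel H =>
      cos (inner a (z : H) + c)) 1) => [|z]; last exact: normr_cos_le1.
    apply: (measurableT_comp (@measurable_cos R)); apply: measurable_funD => //.
    exact: measurable_inner.
  rewrite (Rintegral_cos_gaussian HC a c gQ) (innerC a 0) inner0l add0r -mulrA -expRD.
  by congr (_ * expR _); field.
exact: (measurableT_comp (@measurable_cos R) (measurable_inner_pair a b c)).
Qed.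

Lemma smoothing_mul (u v : H) : phi u * phi v =
  \int[(Q \x Q)%E]_z
    expR (- (sigma * (`|u - (z.1 : H)| ^+ 2 + `|v - (z.2 : H)| ^+ 2))).
Proof.
pose k (w : H) (z : borel H) := expR (- (sigma * `|w - (z : H)| ^+ 2)).
have intk w : Q.-integrable [set: borel H] (fun z => (k w z)%:E).
  apply: (@integrable_bounded _ _ _ _ (k w) 1) => [|z];
    first exact: measurable_sqdist_kernel.
  exact: normr_kernel_le1.
under eq_Rintegral do rewrite mulrDr opprD expRD.
rewrite (@Rintegral_prod1 _ _ _ _ _ Q Q (fun z => k u z.1 * k v z.2) 1).
- transitivity (\int[Q]_z (k u z * phi v)); first by rewrite RintegralZr//;
  exact: intk.
  by apply: eq_Rintegral => z _ /=; rewrite RintegralZl//; exact: intk.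
- apply: measurable_funM.
    exact: (measurableT_comp (measurable_sqdist_kernel u) measurable_fst).
  exact: (measurableT_comp (measurable_sqdist_kernel v) measurable_snd).
- by move=> z; rewrite normrM mulr_ile1 ?normr_kernel_le1.
Qed.

(* The law of the pair of independent copies is invariant under the rotation by
   pi / 4, and so is the squared norm. *)
Lemma smoothing_rotate (r : R) (u v : H) : r ^+ 2 = 2^-1 ->
  phi u * phi v = phi (r *: (u + v)) * phi (r *: (u - v)).
Proof.
rewrite expr2 => rr; have [_ _ _ [e basis_e _]] := HC.
have rot (a b : H) : `|a| ^+ 2 + `|b| ^+ 2 =
    `|r *: (a + b)| ^+ 2 + `|r *: (a - b)| ^+ 2.
  rewrite -!inner_norm !(innerZl, innerZr) !mulrA rr.
  by rewrite !inner_norm sqr_normD sqr_normB; field.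
rewrite !smoothing_mul.
pose x1 (z : borel H * borel H) : H := r *: ((u - (z.1 : H)) + (v - (z.2 : H))).
pose x2 (z : borel H * borel H) : H := r *: ((u - (z.1 : H)) - (v - (z.2 : H))).
pose x1' (z : borel H * borel H) : H := r *: (u + v) - (z.1 : H).
pose x2' (z : borel H * borel H) : H := r *: (u - v) - (z.2 : H).
(* The integrand is rotated pointwise first; it then remains to match the cosine integrals of
   [(x1, x2)] and [(x1', x2')]. *)
transitivity (\int[(Q \x Q)%E]_z expR (- (sigma * (`|x1 z| ^+ 2 + `|x2 z| ^+ 2)))).
  apply: eq_Rintegral => z _; congr (expR (- (_ * _))).
  exact: rot.
have x1E a z : inner a (x1 z) = inner (- (r *: a)) (z.1 : H) +
  inner (- (r *: a)) (z.2 : H) + inner a (r *: (u + v)).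
  by rewrite /x1 !(innerZr, innerDr, innerNr, innerNl, innerZl); ring.
have x2E a z : inner a (x2 z) = inner (- (r *: a)) (z.1 : H) +
  inner (r *: a) (z.2 : H) + inner a (r *: (u - v)).
  by rewrite /x2 !(innerZr, innerDr, innerNr, innerNl, innerZl); ring.
have x1'E a z : inner a (x1' z) = inner (- a) (z.1 : H) + inner 0 (z.2 : H) +
  inner a (r *: (u + v)).
  by rewrite /x1' !(innerZr, innerDr, innerNr, innerNl, innerZl, inner0l); ring.
have x2'E a z : inner a (x2' z) = inner 0 (z.1 : H) + inner (- a) (z.2 : H) +
  inner a (r *: (u - v)).
  by rewrite /x2' !(innerZr, innerDr, innerNr, innerNl, innerZl, inner0l); ring.
apply: (Rintegral_kernel_eq sigma0 basis_e (x1 := x1) (x1' := x1')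
  (x2 := x2) (x2' := x2')).
- by move=> a; under eq_fun do rewrite x1E; exact: measurable_inner_pair.
- by move=> a; under eq_fun do rewrite x2E; exact: measurable_inner_pair.
- by move=> a; under eq_fun do rewrite x1'E; exact: measurable_inner_pair.
- by move=> a; under eq_fun do rewrite x2'E; exact: measurable_inner_pair.
move=> a b.
pose c := inner a (r *: (u + v)) + inner b (r *: (u - v)).
transitivity (\int[(Q \x Q)%E]_z cos (inner (- (r *: (a + b))) (z.1 : H) +
  inner (- (r *: (a - b))) (z.2 : H) + c)).
  apply: eq_Rintegral => z _; congr cos; rewrite x1E x2E /c.
  by rewrite !(innerZr, innerDr, innerNr, innerNl, innerZl, innerDl); ring.
transitivity (\int[(Q \x Q)%E]_z cos (inner (- a) (z.1 : H) +
  inner (- b) (z.2 : H) + c)); last first.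
  apply: eq_Rintegral => z _; congr cos; rewrite x1'E x2'E /c.
  by rewrite !inner0l; ring.
rewrite !Rintegral_cos_gaussian2; congr (_ * expR (- (_ / 2))).
have CN x : inner (C (- x)) (- x) = inner (C x) x.
  by rewrite (linearN C) innerNl innerNr opprK.
have CZ x : inner (C (r *: x)) (r *: x) = 2^-1 * inner (C x) x.
  by rewrite (linearZ_LR C)/= innerZl innerZr mulrA rr.
(* The cross terms of the covariance form at [a + b] and [a - b] cancel. *)
rewrite !CN !CZ !(linearD C, linearN C)/= !(innerDl, innerDr, innerNl, innerNr).
by field.
Qed.

End Gaussian_kernel.

(** * Positivity of integrals and integration against finite products *)

Lemma Rintegral_prob_cst d (T : measurableType d) (R : realType)
    (P : probability T R) (r : R) : \int[P]_x (r : R) = r.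
Proof.
rewrite Rintegral_cst//; rewrite -[RHS]mulr1; congr (_ * _).
by transitivity (fine (1 : \bar R)) => //; congr fine; exact: probability_setT.
Qed.

(** A zero integral would make [f] vanish almost everywhere, so the whole space, of mass 1, would
    lie in a null set. *)
Lemma Rintegral_gt0 d (T : measurableType d) (R : realType) (P : probability T R)
    (f : T -> R) (M : R) :
  measurable_fun [set: T] f -> (forall x, `|f x| <= M) -> (forall x, 0 < f x) ->
  0 < \int[P]_x f x.
Proof.
move=> mf fM f0; rewrite lt_neqAle Rintegral_ge0 => [|x _]; last exact: ltW.
rewrite andbT eq_sym; apply/eqP => intf0.
have intf := integrable_bounded P mf fM.
have : (\int[P]_x `|(EFin \o f) x| = 0)%E.
  under eq_integral do rewrite /= gtr0_norm//.
  by rewrite -(fineK (integrable_fin_num measurableT intf)) [fine _]intf0.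
move/(ae_eq_integral_abs P measurableT (measurable_int P intf)) => [N [mN PN]].
rewrite (_ : ~` _ = setT); last first.
  by apply/seteqP; split => x // _ /= /(_ I) [] /eqP; rewrite gt_eqF.
move=> TN; have : (P [set: T] <= P N)%E by apply: le_measure => //; rewrite inE.
by rewrite PN probability_setT lee_fin ler10.
Qed.

(** Induction along the recursion of [product_prob]: change of variables through [cons_pair], then
    Fubini. The bound 1 is stable under products. *)
Lemma Rintegral_product_prob d (T : measurableType d) (R : realType) n
    (Q : 'I_n -> probability T R) (f : 'I_n -> T -> R) :
  (forall i, measurable_fun [set: T] (f i)) -> (forall i x, `|f i x| <= 1) ->
  \int[product_prob Q]_z (\prod_(i < n) f i (tnth z i)) =
  \prod_(i < n) \int[Q i]_x f i x.
Proof.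
elim: n Q f => [|n IH] Q f mf f1.
  by rewrite big_ord0; under eq_Rintegral do rewrite big_ord0;
    rewrite Rintegral_prob_cst.
pose P' := product_prob (fun i => Q (lift ord0 i)).
pose F (z : n.-tuple T) := \prod_(i < n) f (lift ord0 i) (tnth z i).
have mF : measurable_fun [set: n.-tuple T] F.
  apply: measurable_prod => i _.
  exact: (measurableT_comp (mf _) (measurable_tnth i)).
have F1 z : `|F z| <= 1.
  rewrite normr_prod; apply: prodr_ile1 => i _; rewrite normr_ge0; exact: f1.
have mG : measurable_fun [set: n.+1.-tuple T] (fun z : n.+1.-tuple T =>
  \prod_(i < n.+1) f i (tnth z i)).
  apply: measurable_prod => i _.
  exact: (measurableT_comp (mf _) (measurable_tnth i)).
have G1 (z : n.+1.-tuple T) : `|\prod_(i < n.+1) f i (tnth z i)| <= 1.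
  rewrite normr_prod; apply: prodr_ile1 => i _; rewrite normr_ge0; exact: f1.
have consE (x : T * n.-tuple T) :
    \prod_(i < n.+1) f i (tnth (cons_pair x) i) = f ord0 x.1 * F x.2.
  rewrite big_ord_recl; congr (_ * _); apply: eq_bigr => i _.
  by rewrite /cons_pair tnthS.
transitivity (\int[(Q ord0 \x P')%E]_x (f ord0 x.1 * F x.2)).
  rewrite /Rintegral integral_distribution/=; last 2 first.
  - exact/measurable_EFinP.
  - apply: (@integrable_bounded _ _ _ _
      (fun x => \prod_(i < n.+1) f i (tnth (cons_pair x) i)) 1) => [|x];
        last exact: G1.
    exact: (measurableT_comp mG (@measurable_cons_pair _ _ n)).
  by congr fine; apply: eq_integral => x _ /=; rewrite consE.
rewrite (@Rintegral_prod1 _ _ _ _ _ _ _ (fun x => f ord0 x.1 * F x.2) 1).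
- rewrite big_ord_recl -IH//.
  transitivity (\int[Q ord0]_x (f ord0 x * \int[P']_z F z)).
    apply: eq_Rintegral => x _ /=; rewrite RintegralZl//.
    exact: integrable_bounded mF F1.
  by rewrite RintegralZr//; exact: (integrable_bounded _ (mf ord0) (f1 ord0)).
- apply: measurable_funM.
    exact: (measurableT_comp (mf ord0) measurable_fst).
  exact: (measurableT_comp mF measurable_snd).
- by move=> z; rewrite normrM mulr_ile1.
Qed.

Section smoothing_bounds.
Context (R : realType) (H : hilbertType R) (sigma : R) (Q : probability (borel H) R).
Hypothesis sigma0 : 0 < sigma.

Lemma smoothing_gt0 (u : H) : 0 < smoothing sigma Q u.
Proof.
apply: (@Rintegral_gt0 _ _ _ _ _ 1) => [|z|z]; last exact: expR_gt0.
  exact: measurable_sqdist_kernel.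
exact: normr_kernel_le1.
Qed.

Lemma smoothing_le1 (u : H) : smoothing sigma Q u <= 1.
Proof.
apply: (@le_trans _ _ (\int[Q]_z 1)); last first.
  by rewrite Rintegral_prob_cst.
apply: (@le_Rintegral_bounded _ _ _ _ _ _ 1 1) => // [|z|z|z].
- exact: measurable_sqdist_kernel.
- exact: normr_kernel_le1.
- by rewrite normr1.
- by apply: le_trans (ler_norm _) _; exact: normr_kernel_le1.
Qed.

(** The inequality [|u - z| ^+ 2 <= 2 * |u| ^+ 2 + 2 * |z| ^+ 2] separates [u] from [z], at the
    price of doubling [sigma]. *)
Lemma smoothing_ge (u : H) :
  expR (- (2 * sigma * `|u| ^+ 2)) * smoothing (2 * sigma) Q 0 <= smoothing sigma Q u.
Proof.
have s20 : 0 < 2 * sigma by rewrite mulr_gt0.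
rewrite -RintegralZl//; last first.
  apply: (@integrable_bounded _ _ _ _ (fun z : borel H =>
    expR (- (2 * sigma * `|0 - (z : H)| ^+ 2))) 1) => [|z].
    exact: measurable_sqdist_kernel.
  exact: normr_kernel_le1.
apply: (@le_Rintegral_bounded _ _ _ _ _ _ 1 1) => // [||z|z|z].
- by apply: measurable_funM => //; exact: measurable_sqdist_kernel.
- exact: measurable_sqdist_kernel.
- by rewrite normrM mulr_ile1 ?normr_kernel_le1.
- exact: normr_kernel_le1.
rewrite -expRD ler_expR sub0r normrN.
have := sqr_ge0 `|u + (z : H)|; rewrite sqr_normB sqr_normD; nra.
Qed.

(** For fixed [z] the kernel tends to 0, and it is bounded by 1. Powers of 2 suit the scaling rule
    [energy_pow2]. *)
Lemma cvg_smoothing_pow (u : H) : u != 0 ->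
  smoothing sigma Q (2 ^+ n *: u) @[n --> \oo] --> 0.
Proof.
move=> u0; have u1 : 0 < `|u| by rewrite normr_gt0.
rewrite -[X in _ --> X](_ : \int[Q]_z 0 = 0); last by rewrite Rintegral_prob_cst.
apply: (@cvg_Rintegral_bounded _ _ _ _ _ _ 1) => //.
- by move=> n; exact: measurable_sqdist_kernel.
- by move=> n z; exact: normr_kernel_le1.
move=> z; apply: (cvg_comp (fun n => sigma * `|2 ^+ n *: u -
  (z : H)| ^+ 2) (fun x => expR (- x))); last exact: cvgr_expR.
apply/cvgryPge => A; near=> n.
(* This threshold gives distance at least [1 + |A| / sigma], whose square exceeds [|A| / sigma]. *)
have nA : (`|(z : H)| + 1 + `|A| / sigma) / `|u| <= n%:R.
  by near: n; exact: nbhs_infty_ger.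
have n2 : n%:R <= 2 ^+ n :> R by rewrite -natrX ler_nat ltnW// ltn_expl.
have w_ge : 1 + `|A| / sigma <= `|2 ^+ n *: u - (z : H)|.
  apply: le_trans (lerB_dist _ _); rewrite normrZ ger0_norm ?exprn_ge0// lerBrDr.
  rewrite ler_pdivrMr// in nA; apply: le_trans (_ : n%:R * `|u| <= _);
    last by rewrite ler_pM2r.
  by apply: le_trans nA; rewrite addrC addrA.
have A0 : 0 <= `|A| / sigma by rewrite divr_ge0// ltW.
apply: (@le_trans _ _ (sigma * (`|A| / sigma))).
  by rewrite mulrC divfK ?gt_eqF// ler_norm.
rewrite ler_pM2l//; move: w_ge A0; set w := `|_ - _|; nra.
Unshelve. all: by end_near. Qed.

End smoothing_bounds.

(** * Quadratic forms *)

(** The additive function [f t - t * f 1] vanishes at integers, so it is bounded through its values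
    on fractional parts. A bounded additive function is zero, as its values at multiples [n * t]
    show. *)
Lemma additive_bounded_linear (R : realType) (f : R -> R) (M : R) :
  (forall s t, f (s + t) = f s + f t) -> (forall t, `|t| <= 1 -> `|f t| <= M) ->
  forall t, f t = t * f 1.
Proof.
move=> fD fM.
have f0 : f 0 = 0 by apply: (addrI (f 0)); rewrite -fD !addr0.
have fN t : f (- t) = - f t.
  by apply/eqP; rewrite -addr_eq0 -fD addNr f0.
have fn n t : f (n%:R * t) = n%:R * f t.
  elim: n => [|n IH]; first by rewrite !mul0r f0.
  by rewrite -natr1 !mulrDl fD IH !mul1r.
suff f_ge0 t : 0 <= t -> f t = t * f 1.
  move=> t; have [/f_ge0//|/ltW t0] := leP 0 t.
  by apply: oppr_inj; rewrite -fN f_ge0 ?oppr_ge0// mulNr.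
move=> t0; apply/eqP; rewrite -subr_eq0 -normr_le0; apply/ler_addgt0Pr => eps eps0.
rewrite add0r.
(* Chosen so that the uniform bound [M + |f 1|], divided by [n], is below [eps]. *)
pose n := (Num.truncn ((M + `|f 1|) / eps)).+1.
have n0 : 0 < n%:R :> R by rewrite ltr0n.
rewrite -(ler_pM2l n0) -[X in X * `|_|](@ger0_norm _ n%:R)// -normrM mulrBr -fn mulrA.
set s := n%:R * t; have s0 : 0 <= s by rewrite mulr_ge0.
have /andP[ks sk] := truncn_itv s0; set k := Num.truncn s in ks sk.
have fk : f k%:R = k%:R * f 1 by rewrite -fn mulr1.
have -> : f s - s * f 1 = f (s - k%:R) - (s - k%:R) * f 1.
  by rewrite fD fN fk; ring.
have sk1 : `|s - k%:R| <= 1.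
  by rewrite ger0_norm ?subr_ge0// lerBlDl natr1 ltW.
apply: le_trans (ler_normB _ _) _.
apply: (@le_trans _ _ (M + `|f 1|)).
  by rewrite lerD ?fM// normrM ler_piMl.
by rewrite -ler_pdivrMr// ltW// truncnS_gt.
Qed.

Section parallelogram.
Context (R : realType) (V : normedModType R) (q : V -> R) (K : R).
Hypothesis q_parallelogram : forall u v, q (u + v) + q (u - v) = 2 * (q u + q v).
Hypothesis K_ge0 : 0 <= K.
Hypothesis q_ge0 : forall u, 0 <= q u.
Hypothesis q_le : forall u, q u <= K * `|u| ^+ 2.

Definition polar u v := (q (u + v) - q (u - v)) / 4.

Let q0 : q 0 = 0.
Proof. by have := q_parallelogram 0 0; rewrite subrr addr0; lra. Qed.

Let qN u : q (- u) = q u.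
Proof. by have := q_parallelogram 0 u; rewrite q0 sub0r add0r; lra. Qed.

Lemma polarC u v : polar u v = polar v u.
Proof. by rewrite /polar [v + u]addrC -[v - u]opprB qN. Qed.

(** The Jordan-von Neumann argument: [half] subtracts the parallelogram laws at [(x + w, y + w)] and
    [(x - w, y - w)]; its case [y = 0] then removes the doubled [w]. *)
Lemma polarDl u v w : polar (u + v) w = polar u w + polar v w.
Proof.
have half x y : polar x w + polar y w = polar (x + y) (w + w) / 2.
  have h1 := q_parallelogram (x + w) (y + w).
  have h2 := q_parallelogram (x - w) (y - w).
  have e1 : x + w + (y + w) = x + y + (w + w) by rewrite addrACA.
  have e2 : x - w + (y - w) = x + y - (w + w) by rewrite addrACA opprD.
  have e3 : x + w - (y + w) = x - y by rewrite opprD addrACA subrr addr0.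
  have e4 : x - w - (y - w) = x - y by rewrite opprD addrACA subrr addr0.
  rewrite e1 e3 in h1; rewrite e2 e4 in h2; rewrite /polar; lra.
have p0 : polar 0 w = 0 by rewrite /polar sub0r add0r qN subrr mul0r.
have := half (u + v) 0; rewrite p0 !addr0 => ->.
by rewrite half.
Qed.

(** As a function of the scalar it is additive, and bounded on [[-1, 1]] because [q] is bounded on
    balls. *)
Lemma polarZl t u v : polar (t *: u) v = t * polar u v.
Proof.
pose M := K * (`|u| + `|v|) ^+ 2.
have q_leM s : `|s| <= 1 -> q (s *: u + v) <= M /\ q (s *: u - v) <= M.
  move=> s1; have su : `|s *: u| <= `|u| by rewrite normrZ ler_piMl.
  have sq (x : V) : `|x| <= `|u| + `|v| -> q x <= M.
    move=> xuv; rewrite (le_trans (q_le x))// ler_wpM2l//.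
    by apply: lerXn2r; rewrite ?nnegrE ?addr_ge0.
  split; apply: sq; first by rewrite (le_trans (ler_normD _ _))// lerD2r.
  by rewrite (le_trans (ler_normB _ _))// lerD2r.
pose f s := polar (s *: u) v.
rewrite -[u in RHS]scale1r -/(f t) -/(f 1).
apply: (@additive_bounded_linear _ f M) => [s s'|s /q_leM[h1 h2]].
  by rewrite /f scalerDl polarDl.
have := q_ge0 (s *: u + v); have := q_ge0 (s *: u - v).
by rewrite /f /polar ler_norml; move=> h3 h4; apply/andP; split; lra.
Qed.

Lemma polar_suml (I : Type) (r : seq I) (P : pred I) (F : I -> V) v :
  polar (\sum_(i <- r | P i) F i) v = \sum_(i <- r | P i) polar (F i) v.
Proof.
apply: (big_morph (fun u => polar u v)) => [x y|]; first exact: polarDl.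
by rewrite -(scale0r 0) polarZl mul0r.
Qed.

Lemma quadD u v : q (u + v) = q u + q v + 2 * polar u v.
Proof. by have := q_parallelogram u v; rewrite /polar; lra. Qed.

End parallelogram.

(** Dividing by [4 ^+ m] washes out the additive constant [c]. With the scaling of [energy], it
    turns bounds up to a constant into exact ones. *)
Lemma ler_of_pow4 (R : realType) (a b c : R) :
  (forall m, 4 ^+ m * a <= 4 ^+ m * b + c) -> a <= b.
Proof.
move=> H; apply/ler_addgt0Pr => eps eps0.
pose m := (Num.truncn (c / eps)).+1.
have c_le : c <= 4 ^+ m * eps.
  rewrite -ler_pdivrMr//; apply: (@le_trans _ _ m%:R);
    first by rewrite ltW// truncnS_gt.
  by rewrite -natrX ler_nat ltnW// ltn_expl.
have p0 : 0 < 4 ^+ m :> R by rewrite exprn_gt0.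
by rewrite -(ler_pM2l p0) (le_trans (H m))// mulrDr lerD2l.
Qed.

(** * The logarithm of the smoothed kernel as a definite quadratic form *)

Section energy.
Context (R : realType) (V : normedModType R) (phi : V -> R) (K D : R).
Hypothesis D_gt0 : 0 < D.
Hypothesis phi_le1 : forall u, phi u <= 1.
Hypothesis phi_ge : forall u, expR (- (K * `|u| ^+ 2)) * D <= phi u.
Hypothesis phi_rotate : forall (r : R) u v, r ^+ 2 = 2^-1 ->
  phi u * phi v = phi (r *: (u + v)) * phi (r *: (u - v)).
Hypothesis cvg_phi : forall u, u != 0 -> phi (2 ^+ n *: u) @[n --> \oo] --> 0.

Definition energy (u : V) : R := ln (phi 0) - ln (phi u).

Let phi_gt0 u : 0 < phi u.
Proof. by apply: lt_le_trans (phi_ge u); rewrite mulr_gt0 ?expR_gt0. Qed.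

Lemma energyE u : phi u = phi 0 * expR (- energy u).
Proof.
rewrite /energy opprB expRD expRN !lnK ?posrE//.
by rewrite mulrC divfK// gt_eqF.
Qed.

Let energy0 : energy 0 = 0. Proof. exact: subrr. Qed.

(** The logarithm of the rotation identity carries a factor [r]; its case [v = 0] gives
    [energy x = 2 * energy (r *: x)], which removes that factor. *)
Lemma energy_parallelogram u v :
  energy (u + v) + energy (u - v) = 2 * (energy u + energy v).
Proof.
pose r : R := (Num.sqrt 2)^-1.
have rot x y : energy x + energy y = energy (r *: (x + y)) + energy (r *: (x - y)).
  have r2 : r ^+ 2 = 2^-1 by rewrite exprVn sqr_sqrtr.
  have /(congr1 (@ln R)) := phi_rotate x y r2.
  by rewrite !lnM ?posrE// /energy; lra.
have half x : energy x = 2 * energy (r *: x).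
  by have := rot x 0; rewrite addr0 subr0 energy0; lra.
by rewrite (half (u + v)) (half (u - v)) rot; ring.
Qed.

Lemma energy_pow2 m u : energy (2 ^+ m *: u) = 4 ^+ m * energy u.
Proof.
elim: m => [|m IH]; first by rewrite !expr0 scale1r mul1r.
have := energy_parallelogram (2 ^+ m *: u) (2 ^+ m *: u).
have -> : 2 ^+ m *: u + 2 ^+ m *: u = 2 ^+ m.+1 *: u.
  by rewrite -scalerDl exprS mulr_natl mulr2n.
by rewrite subrr energy0 addr0 IH => ->; rewrite exprS; ring.
Qed.

(** The bound [phi <= 1] only gives [energy >= ln (phi 0)]; applied at [2 ^+ m *: u], it improves to
    0. *)
Lemma energy_ge0 u : 0 <= energy u.
Proof.
apply: (@ler_of_pow4 _ _ _ (- ln (phi 0))) => m; rewrite mulr0 -energy_pow2 /energy.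
have := ln_le0 (phi_le1 (2 ^+ m *: u)); lra.
Qed.

Lemma energy_le u : energy u <= K * `|u| ^+ 2.
Proof.
have H1 w : energy w <= K * `|w| ^+ 2 + (ln (phi 0) - ln D).
  have := phi_ge w; rewrite -ler_ln ?posrE ?mulr_gt0 ?expR_gt0//.
  by rewrite lnM ?posrE ?expR_gt0// expRK /energy; lra.
apply: (@ler_of_pow4 _ _ _ (ln (phi 0) - ln D)) => m; rewrite -energy_pow2.
apply: le_trans (H1 _) _; rewrite normrZ ger0_norm ?exprn_ge0// exprMn exprAC.
have -> : 2 ^+ 2 = 4 :> R by ring.
by rewrite mulrCA.
Qed.

(** Otherwise [phi] would keep the positive value [phi 0] along [2 ^+ n *: u], against its decay. *)
Lemma energy_eq0 u : energy u = 0 -> u = 0.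
Proof.
move=> e0; apply/eqP; apply: contraT => u0.
have E n : phi (2 ^+ n *: u) = phi 0.
  by rewrite energyE energy_pow2 e0 mulr0 oppr0 expR0 mulr1.
have cvg1 : phi (2 ^+ n *: u) @[n --> \oo] --> phi 0.
  by apply: cvg_near_cst; exact: nearW.
have phi0 : phi 0 = 0 by apply: (cvg_unique _ cvg1 (cvg_phi u0)).
by have := phi_gt0 0; rewrite phi0 ltxx.
Qed.

End energy.

(** * Least squares *)

Section matrix_action.
Context (R : realType) (V : lmodType R).

Lemma mulmxHA m n p (A : 'M[R]_(m, n)) (B : 'M[R]_(n, p)) (v : 'I_p -> V) :
  mulmxH A (mulmxH B v) = mulmxH (A *m B) v.
Proof.
apply/funext => i; rewrite /mulmxH.
under eq_bigr do rewrite scaler_sumr.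
rewrite exchange_big; apply: eq_bigr => k _; rewrite mxE scaler_suml.
by apply: eq_bigr => j _; rewrite scalerA.
Qed.

Lemma mul1mxH n (v : 'I_n -> V) : mulmxH 1%:M v = v.
Proof.
apply/funext => i; rewrite /mulmxH (bigD1 i)//= mxE eqxx scale1r big1 ?addr0// =>
  j ji.
by rewrite mxE eq_sym (negbTE ji) scale0r.
Qed.

Lemma mulmxHB m n (A : 'M[R]_(m, n)) (v w : 'I_n -> V) i :
  mulmxH A (fun j => v j - w j) i = mulmxH A v i - mulmxH A w i.
Proof.
by rewrite /mulmxH -sumrB; apply: eq_bigr => j _; rewrite scalerBr.
Qed.

Context (n p : nat) (X : 'M[R]_(n, p)).
Hypothesis HX : X^T *m X \in unitmx.

(** The matrix [invmx (X^T *m X) *m X^T] is a left inverse of [X]. *)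
Lemma mulmxH_inj (v w : 'I_p -> V) : mulmxH X v =1 mulmxH X w -> v = w.
Proof.
move=> /funext Xvw; rewrite -[v]mul1mxH -[w]mul1mxH -(mulVmx HX).
by rewrite -!mulmxHA Xvw.
Qed.

(** These are the normal equations: [X^T] annihilates the residual. *)
Lemma ols_residual (y : 'I_n -> V) k :
  \sum_(i < n) X i k *: (y i - mulmxH X (ols X y) i) = 0.
Proof.
transitivity (mulmxH X^T (fun i => y i - mulmxH X (ols X y) i) k).
  by apply: eq_bigr => i _; rewrite mxE.
by rewrite mulmxHB mulmxHA /ols mulmxHA mulmxA mulmxV// mul1mx subrr.
Qed.

End matrix_action.

Section least_squares.
Context (R : realType) (V : normedModType R) (q : V -> R) (K : R).
Hypothesis q_parallelogram : forall u v, q (u + v) + q (u - v) = 2 * (q u + q v).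
Hypothesis K_ge0 : 0 <= K.
Hypothesis q_ge0 : forall u, 0 <= q u.
Hypothesis q_le : forall u, q u <= K * `|u| ^+ 2.
Context (n p : nat) (X : 'M[R]_(n, p)) (y : 'I_n -> V).
Hypothesis HX : X^T *m X \in unitmx.

(** Pythagoras for the form [q]: bilinearity moves [X] onto the residuals, where the normal
    equations make the cross term vanish. *)
Lemma quad_residual b : \sum_(i < n) q (y i - mulmxH X b i) =
  \sum_(i < n) q (y i - mulmxH X (ols X y) i) +
  \sum_(i < n) q (mulmxH X (fun k => ols X y k - b k) i).
Proof.
set r := fun i => y i - mulmxH X (ols X y) i.
set h := fun k => ols X y k - b k.
have cross : \sum_(i < n) polar q (mulmxH X h i) (r i) = 0.
  transitivity (\sum_(k < p) polar q (\sum_(i < n) X i k *: r i) (h k)).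
    under [RHS]eq_bigr => k _ do
      rewrite (polar_suml q_parallelogram K_ge0 q_ge0 q_le).
    rewrite exchange_big; apply: eq_bigr => i _.
    rewrite (polar_suml q_parallelogram K_ge0 q_ge0 q_le); apply: eq_bigr => k _.
    rewrite !(polarZl q_parallelogram K_ge0 q_ge0 q_le).
    by rewrite (polarC q_parallelogram).
  rewrite big1 // => k _; rewrite ols_residual// -(scale0r 0).
  by rewrite (polarZl q_parallelogram K_ge0 q_ge0 q_le) mul0r.
transitivity (\sum_(i < n) (q (r i) + q (mulmxH X h i) +
  2 * polar q (mulmxH X h i) (r i))).
  apply: eq_bigr => i _.
  have -> : y i - mulmxH X b i = mulmxH X h i + r i.
    by rewrite /h mulmxHB /r [RHS]addrC addrA subrK.
  by rewrite (quadD q_parallelogram) [q (r i) + _]addrC.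
by rewrite !big_split/= -mulr_sumr cross mulr0 addr0.
Qed.

Hypothesis q_eq0 : forall u, q u = 0 -> u = 0.

(** The excess over the value at [ols X y] is a sum of nonnegative terms. At a minimizer each is
    zero, so definiteness and injectivity of [X] force equality. *)
Lemma quad_argmin b :
  (forall b', \sum_(i < n) q (y i - mulmxH X b i) <=
              \sum_(i < n) q (y i - mulmxH X b' i)) <-> b = ols X y.
Proof.
split=> [/(_ (ols X y))|-> b']; last first.
  by rewrite (quad_residual b') lerDl sumr_ge0.
rewrite (quad_residual b) gerDl => le0.
apply/esym/(mulmxH_inj HX) => i; apply/eqP; rewrite -subr_eq0 -mulmxHB; apply/eqP.
apply: q_eq0; apply/eqP.
have /eqP := le_anti (introT andP (conj le0 (sumr_ge0 _ (fun i _ => q_ge0 _)))).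
by rewrite psumr_eq0 => [|j _]//; move=> /allP/(_ i (mem_index_enum i)).
Qed.

End least_squares.

(** * From the kernel mean to least squares *)

Lemma kernel_meanE (R : realType) (H : hilbertType R) (n p : nat)
    (X : 'M[R]_(n, p)) (C : {linear H -> H}) (HC : covariance_operator C)
    (Q : probability (borel H) R) (gQ : is_gaussian Q 0 C)
    (sigma : R) (sigma0 : 0 < sigma) (b : 'I_p -> H) (y : 'I_n -> H) :
  kernel_mean X C sigma b y =
  \prod_(i < n) smoothing sigma Q (y i - mulmxH X b i).
Proof.
pose k i (z : borel H) := expR (- (sigma * `|y i - (z : H)| ^+ 2)).
have mk i : measurable_fun [set: borel H] (k i) by exact: measurable_sqdist_kernel.
have k1 i z : `|k i z| <= 1 by exact: normr_kernel_le1.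
transitivity (\prod_(i < n) smoothing sigma (gaussian (mulmxH X b i) C) (y i)).
  rewrite -(Rintegral_product_prob (fun i => gaussian (mulmxH X b i) C) mk k1).
  by apply: eq_Rintegral => z _; rewrite mulr_sumr -sumrN expR_sum.
(* Each factor is recentered, so that all of them are values of one function. *)
apply: eq_bigr => i _; apply: (smoothing_shift HC sigma0 gQ).
exact: (gaussianP HC _ gQ).
Qed.

Section maximum_kernel_mean.
Context (R : realType) (H : hilbertType R) (n p : nat) (X : 'M[R]_(n, p)).
Hypothesis HX : X^T *m X \in unitmx.
Context (C : {linear H -> H}).
Hypothesis HC : covariance_operator C.
Context (Q : probability (borel H) R).
Hypothesis gQ : is_gaussian Q 0 C.
Context (sigma : R).
Hypothesis sigma0 : 0 < sigma.

(** The kernel mean is a positive constant times [expR] of minus the total energy of the residuals,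
    so maximizing it is minimizing a definite quadratic form, with [K = 2 * sigma]. *)
Lemma mkm_ols (y : 'I_n -> H) (b : 'I_p -> H) :
  is_mkm_estimate X C sigma y b <-> b = ols X y.
Proof.
have s20 : 0 < 2 * sigma by rewrite mulr_gt0.
have D0 := smoothing_gt0 Q s20 0.
have le1 := smoothing_le1 Q sigma0.
have ge := smoothing_ge Q sigma0.
have rot := smoothing_rotate HC sigma0 gQ.
have dec := cvg_smoothing_pow Q sigma0.
have phi0 : 0 < smoothing sigma Q 0 by exact: smoothing_gt0.
have km b' := kernel_meanE X HC gQ sigma0 b' y.
set phi := smoothing sigma Q in le1 ge rot dec phi0 km.
have par := energy_parallelogram D0 ge rot.
have ge0 := energy_ge0 D0 le1 ge rot.
have le := energy_le D0 ge rot.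
have eq0 := energy_eq0 D0 ge rot dec.
have E b' : kernel_mean X C sigma b' y =
    phi 0 ^+ n * expR (- \sum_(i < n) energy phi (y i - mulmxH X b' i)).
  rewrite km -sumrN expR_sum.
  transitivity (\prod_(i < n) (phi 0 * expR (- energy phi (y i - mulmxH X b' i)))).
    by apply: eq_bigr => i _; exact: (energyE D0 ge).
  by rewrite big_split/= prodr_const card_ord.
apply: iff_trans (quad_argmin par (ltW s20) ge0 le y HX eq0 b).
have leE b1 b2 : (kernel_mean X C sigma b1 y <= kernel_mean X C sigma b2 y) =
    (\sum_(i < n) energy phi (y i - mulmxH X b2 i) <=
     \sum_(i < n) energy phi (y i - mulmxH X b1 i)).
  by rewrite (E b1) (E b2) ler_pM2l ?exprn_gt0// ler_expR lerN2.
by split=> opt b'; [rewrite -leE|rewrite leE]; apply: opt.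
Qed.

End maximum_kernel_mean.

Unset Implicit Arguments.

Theorem proposition8 (R : realType) (H : hilbertType R)
    (Hsep : separable H) (Hinf : infinite_dimensional H)
    (n p : nat) (X : 'M[R]_(n, p)) (HX : X^T *m X \in unitmx)
    (C : {linear H -> H}) (HC : covariance_operator C)
    (d : measure_display) (Omega : measurableType d) (P : probability Omega R)
    (eps : 'I_n -> {RV P >-> borel H})
    (eps_gaussian : forall i, is_gaussian (distribution P (eps i)) 0 C)
    (eps_indep : mutually_independent eps)
    (beta : 'I_p -> H)
    (omega : Omega) (y : 'I_n -> H)
    (Hy : forall i, y i = mulmxH X beta i + (eps i omega : H))
    (sigma : R) (Hsigma : 0 < sigma) :
  forall b : 'I_p -> H, is_mkm_estimate X C sigma y b <-> b = ols X y.
Proof.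
(* With no observation there is no error to supply a centered Gaussian law, but injectivity of [X]
   then makes all parameters equal. Otherwise the law of the first error serves as [Q]. *)
move=> b; case: n X HX eps eps_gaussian eps_indep y Hy =>
  [|m] X' HX' eps' gauss' _ y' _.
  have bE (b' : 'I_p -> H) : b' = ols X' y' by apply: (mulmxH_inj HX') => -[].
  by split=> [_|_ b']; [exact: bE|rewrite (bE b) (bE b')].
exact: (mkm_ols HX' HC (gauss' ord0) Hsigma y' b).
Qed.
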